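(* (a) Let $s$ be a twistor line of $\mathcal M_{DH}(\Sigma,\mathrm{SL}(2,\mathbb C))\to\mathbb{CP}^1$ corresponding to an equivariant harmonic map $f\colon\tilde\Sigma\to H^3=\mathrm{SL}(2,\mathbb C)/\mathrm{SU}(2)$, where $H^3$ carries its metric of constant sectional curvature $-1$. Then $$\mathcal E(s)=-\tfrac1{4\pi}\,\mathrm{energy}(f),$$ where $\mathrm{energy}(f)$ is the energy of $f$ on $\Sigma$. In particular $\mathcal E(s)\le0$ for every twistor line $s$. (b) Let $s$ be a $\rho$-negative holomorphic section of $\mathcal M_{DH}(\Sigma,\mathrm{SL}(2,\mathbb C))\to\mathbb{CP}^1$ corresponding to an equivariant harmonic map $f\colon\tilde\Sigma\to\mathrm{SU}(2)=S^3$, where $\mathrm{SU}(2)$ carries its metric of constant sectional curvature $1$. Then $$\mathcal E(s)=\tfrac1{4\pi}\,\mathrm{energy}(f).$$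
   Context: $\Sigma$ is a compact Riemann surface with universal cover $\tilde\Sigma$; $E\to\Sigma$ is the trivial smooth rank 2 bundle with trivialized determinant and a hermitian metric $h$; $\mathfrak{sl}(E)$ denotes trace-free endomorphisms and $*$ the $h$-adjoint (on forms, combined with complex conjugation). $\mathcal M_{DH}(\Sigma,\mathrm{SL}(2,\mathbb C))\to\mathbb{CP}^1$ is the Deligne--Hitchin moduli space: the moduli spaces of polystable holomorphic $\lambda$-connections $(\overline\partial,D)$ (i.e. $D(fv)=\lambda\partial f\otimes v+fDv$, $D\overline\partial+\overline\partial D=0$, inducing trivial structures on $\det E$) on $\Sigma$ and on $\overline\Sigma$, modulo $\mathrm{SL}(2,\mathbb C)$-gauge transformations, glued over $\lambda\neq0$ by $(\overline\partial,D,\lambda)\sim(\lambda^{-1}D,\lambda^{-1}\overline\partial,\lambda^{-1})$. For $\lambda\ne0$ a $\lambda$-connection is identified with the flat connection $\overline\partial+\lambda^{-1}D$. Energy of a section: if near $\lambda=0$ the section $s$ has a lift $(\overline\partial+\lambda\Psi+\dots,\Phi+\lambda\partial+\dots,\lambda)$ to $\lambda$-connections, then $\mathcal E(s)=\frac1{2\pi i}\int_\Sigma\mathrm{tr}(\Phi\wedge\Psi)$ (independent of the lift). Twistor lines: sections represented over $\mathbb C^*$ by $\nabla^\lambda=\lambda^{-1}\Phi+\nabla_h+\lambda\Phi^*$, where $(\overline\partial,\Phi)$ solves the self-duality equations $F^{\nabla_h}+[\Phi\wedge\Phi^*]=0$, $\overline\partial\Phi=0$, with $\nabla_h$ the Chern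 connection of $(\overline\partial,h)$. Under non-abelian Hodge theory such solutions correspond to equivariant harmonic maps $f\colon\tilde\Sigma\to H^3$ (the harmonic metric, viewed in a flat trivialization of $\nabla^{1}$ on $\tilde\Sigma$). $\rho$-negative sections: these are exactly the sections represented over $\mathbb C^*$ by $\nabla^\lambda=\lambda^{-1}\Phi+\nabla_h-\lambda\Phi^*$, where $F^{\nabla_h}-[\Phi\wedge\Phi^*]=0$, $\overline\partial\Phi=0$. The corresponding equivariant harmonic map $f\colon\tilde\Sigma\to\mathrm{SU}(2)$ is the gauge between the flat unitary connections $\nabla^{1}$ and $\nabla^{-1}$ on $\tilde\Sigma$. The energy of an equivariant map $f$ is $\frac12\int_\Sigma|df|^2$, taken over a fundamental domain of $\Sigma$ in $\tilde\Sigma$. *)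

(* Defs.v *)
From HB Require Import structures.
From mathcomp Require Import all_boot all_order all_algebra.
From mathcomp Require Import all_classical all_reals all_analysis.
From mathcomp Require Import complex.

Set Implicit Arguments.
Unset Strict Implicit.
Unset Printing Implicit Defensive.

Import Order.TTheory GRing.Theory Num.Theory.
Import numFieldNormedType.Exports.

Local Open Scope classical_set_scope.
Local Open Scope ring_scope.
Local Open Scope complex_scope.

Section Calculus.
Context {R : realType}.

Fixpoint Ck {V : normedModType R} (k : nat) (U : set V) (f : V -> R) : Prop :=
  {within U, continuous f} /\
  if k is k'.+1 then
    forall v : V, (forall x, U x -> derivable f x v) /\ Ck k' U ('D_v f)
  else True.

(* Meant for open U. *)
Definition smooth {V : normedModType R} (U : set V) (f : V -> R) : Prop :=
  forall k, Ck k U f.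

Definition smoothC {V : normedModType R} (U : set V) (f : V -> R[i]) : Prop :=
  smooth U (fun v => complex.Re (f v)) /\ smooth U (fun v => complex.Im (f v)).

(* [(R[i])^o] carries the topology of C; [derivable _ _ 1] over the field
   R[i] is complex differentiability, [derive1] the complex derivative. *)
Definition holomorphic_on (U : set (R[i])^o) (f : (R[i])^o -> (R[i])^o) : Prop :=
  forall w, U w -> derivable f w 1.

Definition cderiv (f : (R[i])^o -> (R[i])^o) (w : (R[i])^o) : R[i] := derive1 f w.

Definition cplx (v : R * R) : (R[i])^o := v.1 +i* v.2.
Definition plane (w : (R[i])^o) : R * R := (complex.Re w, complex.Im w).

Definition adj m n (M : 'M[R[i]]_(m, n)) : 'M[R[i]]_(n, m) := map_mx conjc M^T.

End Calculus.

Section Surfaces.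
Context {R : realType}.

Record chart (T : Type) := Chart {
  dom : set T;
  coord : T -> (R[i])^o;
  param : (R[i])^o -> T }.

Definition conj_chart (T : Type) (c : chart T) : chart T :=
  Chart (dom c) (fun p => conjc (coord c p)) (fun w => param c (conjc w)).

Definition image_of (T : Type) (c : chart T) : set (R[i])^o := coord c @` dom c.
Definition image2_of (T : Type) (c : chart T) : set (R * R) :=
  cplx @^-1` image_of c.

Definition valid_chart (T : topologicalType) (c : chart T) : Prop :=
  [/\ open (dom c), open (image_of c),
      forall p, dom c p -> param c (coord c p) = p,
      {within dom c, continuous (coord c)} &
      {within image_of c, continuous (param c)}].

Definition holomorphic_transition (T : Type) (c c' : chart T) : Prop :=
  holomorphic_on (coord c @` (dom c `&` dom c')) (coord c' \o param c).

Definition borel (T : ptopologicalType) := g_sigma_algebraType (@open T).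

(* Data of a Riemann surface with an auxiliary conformal metric
   [metric c * |dz|^2] and its area measure.  The metric is used only to make
   sense of the integral of a 2-form w as the integral of w / dA against dA;
   the result does not depend on it.  The axioms are in [riemann_surface]. *)
Record surface := Surface {
  carrier :> ptopologicalType;
  atlas : set (chart carrier);
  chart_at : carrier -> chart carrier;
  metric : chart carrier -> carrier -> R;
  area : {measure set (borel carrier) -> \bar R} }.

(* dz'/dz at p *)
Definition jac (T : Type) (c c' : chart T) (p : T) : R[i] :=
  cderiv (coord c' \o param c) (coord c p).

Definition riemann_surface (X : surface) : Prop :=
  [/\ hausdorff_space X, @second_countable X, connected [set: X] &
   [/\ forall c, atlas c -> @valid_chart X c,
      forall p : X, atlas (chart_at p) /\ dom (chart_at p) p,
      forall c c', @atlas X c -> atlas c' -> holomorphic_transition c c' &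
      (* maximality *)
      forall c, @valid_chart X c ->
        (forall c', atlas c' ->
           holomorphic_transition c c' /\ holomorphic_transition c' c) ->
        atlas c]] /\
  [/\ forall c p, @atlas X c -> dom c p -> 0 < metric c p,
      forall c, @atlas X c ->
        smooth (image2_of c) (fun v => metric c (param c (cplx v))),
      forall c c' p, @atlas X c -> atlas c' -> dom c p -> dom c' p ->
        (metric c p)%:C = (metric c' p)%:C * `|jac c c' p| ^+ 2 &
      forall c (S : set (borel X)), @atlas X c -> measurable S -> S `<=` dom c ->
        area X S = (\int[lebesgue_measure \x lebesgue_measure]_(v in
          [set v : measurableTypeR R * measurableTypeR R |
             (coord c @` S) (cplx v)])
          (metric c (param c (cplx v)))%:E)%E].

Definition compact_riemann_surface (X : surface) : Prop :=
  riemann_surface X /\ compact [set: X].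

Definition conj_surface (X : surface) : surface :=
  @Surface X [set c | atlas (conj_chart c)]
    (fun p => conj_chart (chart_at p))
    (fun c => metric (conj_chart c)) (area X).

Definition simply_connected (T : topologicalType) : Prop :=
  connected [set: T] /\
  forall l : R -> T, {within `[0, 1], continuous l} -> l 0 = l 1 ->
    exists F : R * R -> T,
      {within `[0, 1] `*` `[0, 1], continuous F} /\
      forall t, t \in `[0, 1] ->
        [/\ F (t, 0) = l t, F (t, 1) = l 0, F (0, t) = l 0 & F (1, t) = l 0].

Definition covering (T S : topologicalType) (pr : T -> S) : Prop :=
  continuous pr /\
  forall q : S, exists V : set S, [/\ open V, V q &
    exists sheets : set (set T), [/\ trivIset sheets id,
      pr @^-1` V = \bigcup_(W in sheets) W &
      forall W, sheets W ->
        [/\ open W, pr @` W = V, set_inj W pr &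
            forall W', open W' -> W' `<=` W -> open (pr @` W')]]].

Definition universal_cover (Xt X : surface) (pr : Xt -> X) : Prop :=
  [/\ riemann_surface Xt, simply_connected Xt, covering pr &
      forall (c : chart Xt) (c' : chart X), atlas c -> atlas c' ->
        holomorphic_on (coord c @` (dom c `&` pr @^-1` dom c'))
          (coord c' \o pr \o param c)].

(* A Borel set of representatives of the fibres, i.e. of the deck orbits. *)
Definition fundamental_domain (Xt X : surface) (pr : Xt -> X)
    (D : set (borel Xt)) : Prop :=
  measurable D /\ forall q : X, exists! x : Xt, D x /\ pr x = q.

Definition deck (Xt X : surface) (pr : Xt -> X) (g : Xt -> Xt) : Prop :=
  [/\ continuous g, pr \o g = pr &
      exists h : Xt -> Xt, [/\ continuous h, cancel g h & cancel h g]].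

(* Integral of the 2-form given by w c dx/\dy in each chart c, z = x + iy. *)
Definition int2form (X : surface) (w : chart X -> X -> R[i]) : R[i] :=
  let u (p : X) := w (chart_at p) p / (metric (chart_at p) p)%:C in
  Rintegral (area X) setT (fun p => complex.Re (u p)) +i*
  Rintegral (area X) setT (fun p => complex.Im (u p)).

End Surfaces.

Section Forms.
Context {R : realType}.
Notation M2 := 'M[R[i]]_2.

(* A matrix valued function in the real coordinates of a chart. *)
Definition local_entry (T : Type) (c : chart T) (u : T -> M2) (i j : 'I_2)
  (v : R * R) : R[i] := u (param c (cplx v)) i j.

Definition smooth_chart (T : Type) (c : chart T) (u : T -> M2) : Prop :=
  forall i j, smoothC (image2_of c) (local_entry c u i j).

Definition smooth_map (X : @surface R) (u : X -> M2) : Prop :=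
  forall c, atlas c -> smooth_chart c u.

Definition pd (T : Type) (e : R * R) (c : chart T) (u : T -> M2) (p : T) : M2 :=
  \matrix_(i, j)
   ('D_e (fun v => complex.Re (local_entry c u i j v)) (plane (coord c p)) +i*
    'D_e (fun v => complex.Im (local_entry c u i j v)) (plane (coord c p))).

Definition px (T : Type) := @pd T (1, 0).
Definition py (T : Type) := @pd T (0, 1).

Definition dz (T : Type) (c : chart T) (u : T -> M2) (p : T) : M2 :=
  2^-1 *: (px c u p - (0 +i* 1) *: py c u p).
Definition dzb (T : Type) (c : chart T) (u : T -> M2) (p : T) : M2 :=
  2^-1 *: (px c u p + (0 +i* 1) *: py c u p).

(* A (1,0)- or (0,1)-form with values in End(E) is recorded by its
   coefficient of dz, resp. of d\bar z, in every chart; E = X x C^2. *)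
Definition oneform (T : Type) := @chart R T -> T -> M2.

Definition form10 (X : @surface R) (a : oneform X) : Prop :=
  (forall c, atlas c -> smooth_chart c (a c)) /\
  forall c c' p, atlas c -> atlas c' -> dom c p -> dom c' p ->
    a c p = jac c c' p *: a c' p.

Definition form01 (X : @surface R) (a : oneform X) : Prop :=
  (forall c, atlas c -> smooth_chart c (a c)) /\
  forall c c' p, atlas c -> atlas c' -> dom c p -> dom c' p ->
    a c p = conjc (jac c c' p) *: a c' p.

Definition tracefree (X : @surface R) (a : oneform X) : Prop :=
  forall c p, @atlas R X c -> dom c p -> \tr (a c p) = 0.

(* Coefficient with respect to dx/\dy of tr(a dz /\ b d\bar z);
   dz/\d\bar z = -2i dx/\dy. *)
Definition tr_wedge (X : @surface R) (a b : oneform X) (c : chart X) (p : X) : R[i] :=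
  (0 +i* -2) * \tr (a c p *m b c p).

(* (2 pi i)^-1 \int tr(Phi /\ Psi) *)
Definition pairing (X : @surface R) (Phi Psi : oneform X) : R[i] :=
  (0 +i* (2 * pi))^-1 * int2form (tr_wedge Phi Psi).

End Forms.

Section DeligneHitchin.
Context {R : realType}.
Notation M2 := 'M[R[i]]_2.
Notation oneform := (@oneform R).

(* The lambda-connection (\bar\partial + A, lam \partial + B) on the trivial
   bundle; the induced structures on det E are trivial iff tr A = tr B = 0.
   The last clause is D \bar\partial + \bar\partial D = 0. *)
Definition lconnection (X : @surface R) (lam : R[i]) (A B : oneform X) : Prop :=
  [/\ form01 A, form10 B, tracefree A, tracefree B &
      forall c p, @atlas R X c -> dom c p ->
        lam *: dz c (A c) p - dzb c (B c) p
          + B c p *m A c p - A c p *m B c p = 0].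

(* A smooth line subbundle of E together with a complement: the image and the
   kernel of a field of rank one idempotents. *)
Definition line_splitting (X : @surface R) (P : X -> M2) : Prop :=
  smooth_map P /\ forall p, P p *m P p = P p /\ \tr (P p) = 1.

(* The image of P is preserved by \bar\partial + A and by lam \partial + B. *)
Definition invariant_line (X : @surface R) (lam : R[i]) (A B : oneform X)
    (P : X -> M2) : Prop :=
  forall c p, @atlas R X c -> dom c p ->
    (1%:M - P p) *m (dzb c P p + A c p *m P p) = 0 /\
    (1%:M - P p) *m (lam *: dz c P p + B c p *m P p) = 0.

(* Degree of the image of P by Chern-Weil theory: the connection P o d on it
   has curvature P dP/\dP P, and deg = i/(2 pi) \int tr(P dP/\dP). *)
Definition degree (X : @surface R) (P : X -> M2) : R :=
  complex.Re ((0 +i* (2 * pi)^-1) * int2form (fun (c : chart X) p =>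
    (0 +i* -2) * \tr (P p *m (dz c P p *m dzb c P p - dzb c P p *m dz c P p)))).

Definition stable (X : @surface R) (lam : R[i]) (A B : oneform X) : Prop :=
  forall P : X -> M2, line_splitting P -> invariant_line lam A B P -> degree P < 0.

(* In rank 2 and degree 0: stable, or the direct sum of two invariant line
   bundles of degree 0. *)
Definition polystable (X : @surface R) (lam : R[i]) (A B : oneform X) : Prop :=
  stable lam A B \/
  exists P : X -> M2, [/\ line_splitting P, invariant_line lam A B P,
    invariant_line lam A B (fun p => 1%:M - P p) & degree P = 0].

(* side = true: a lambda-connection on X; side = false: one on the conjugate
   surface. *)
Record dh_rep (T : Type) := DHRep {
  side : bool;
  lam : R[i];
  f01 : oneform T;
  f10 : oneform T }.

Definition dh_valid (X : @surface R) (x : dh_rep X) : Prop :=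
  if side x then
    @lconnection X (lam x) (f01 x) (f10 x) /\ @polystable X (lam x) (f01 x) (f10 x)
  else
    @lconnection (conj_surface X) (lam x) (f01 x) (f10 x) /\
    @polystable (conj_surface X) (lam x) (f01 x) (f10 x).

(* g o (\bar\partial + A) = (\bar\partial + A') o g, and likewise for D. *)
Definition gauge_equiv_on (X : @surface R) (l : R[i]) (A B A' B' : oneform X) : Prop :=
  exists g : X -> M2, [/\ smooth_map g, forall p, \det (g p) = 1 &
    forall c p, @atlas R X c -> dom c p ->
      A' c p *m g p = g p *m A c p - dzb c g p /\
      B' c p *m g p = g p *m B c p - l *: dz c g p].

Definition gauge_equiv (X : @surface R) (x y : dh_rep X) : Prop :=
  [/\ side x = side y, lam x = lam y &
      if side x then @gauge_equiv_on X (lam x) (f01 x) (f10 x) (f01 y) (f10 y)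
      else @gauge_equiv_on (conj_surface X) (lam x)
             (f01 x) (f10 x) (f01 y) (f10 y)].

(* (\bar\partial, D, lam) ~ (lam^-1 D, lam^-1 \bar\partial, lam^-1).
   The coefficient of a form in the chart \bar z of the conjugate surface is
   its coefficient in the chart z of the original one. *)
Definition glue (T : Type) (x : dh_rep T) : dh_rep T :=
  DHRep (~~ side x) (lam x)^-1
    (fun c p => (lam x)^-1 *: f10 x (conj_chart c) p)
    (fun c p => (lam x)^-1 *: f01 x (conj_chart c) p).

Definition dh_equiv (X : @surface R) (x y : dh_rep X) : Prop :=
  gauge_equiv x y \/ (lam x != 0 /\ gauge_equiv (glue x) y).

(* CP^1 is C + {oo}, with None for oo. *)
Definition dh_proj (T : Type) (x : dh_rep T) : option R[i] :=
  if side x then Some (lam x)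
  else if lam x == 0 then None else Some (lam x)^-1.

Definition dh_class (X : @surface R) (x : dh_rep X) : set (dh_rep X) :=
  [set y | dh_valid y /\ dh_equiv x y].

(* Points of the Deligne-Hitchin moduli space are the classes of valid
   representatives. *)
Definition dh_section (X : @surface R) (s : option R[i] -> set (dh_rep X)) : Prop :=
  forall t, exists x, [/\ dh_valid x, dh_proj x = t & s t = dh_class x].

(* (\bar\partial + A l, l \partial + B l, l), l in U, is a lift of s near 0:
   smooth on U x X and holomorphic in l. *)
Definition is_lift (X : @surface R) (s : option R[i] -> set (dh_rep X))
    (U : set (R[i])^o) (A B : R[i] -> oneform X) : Prop :=
  [/\ open U, U 0, forall l, U l -> s (Some l) (DHRep true l (A l) (B l)) &
   forall a, a = A \/ a = B -> forall (c : chart X) i j, atlas c ->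
     (forall p, dom c p -> holomorphic_on U (fun l => a l c p i j)) /\
     smoothC [set u : (R * R) * (R * R) | U (cplx u.1) /\ image2_of c u.2]
       (fun u => local_entry c (a (cplx u.1) c) i j u.2)].

(* The coefficient of l in the expansion of A l at l = 0. *)
Definition first_order (T : Type) (A : R[i] -> oneform T) : oneform T :=
  fun c p => \matrix_(i, j) cderiv (fun l => A l c p i j) 0.

(* E(s) = e.  The energy is computed from any lift of s near 0, and is
   independent of the choice of the lift. *)
Definition has_energy (X : @surface R) (s : option R[i] -> set (dh_rep X))
    (e : R[i]) : Prop :=
  exists (U : set (R[i])^o) (A B : R[i] -> oneform X),
    is_lift s U A B /\ e = pairing (B 0) (first_order A).

End DeligneHitchin.

Section HarmonicSections.
Context {R : realType}.
Notation M2 := 'M[R[i]]_2.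
Notation oneform := (@oneform R).
Notation dh_rep := (@dh_rep R).

Definition posdef (M : M2) : Prop :=
  adj M = M /\ forall v : 'cV[R[i]]_2, v != 0 -> 0 < (adj v *m M *m v) 0 0.

(* The metric h(u, v) = v^* H u on E = X x C^2. *)
Definition hermitian_metric (X : @surface R) (H : X -> M2) : Prop :=
  smooth_map H /\ forall p, posdef (H p).

(* The h-adjoint of a form; swaps types, (phi dz)^* = H^-1 phi^* H d\bar z. *)
Definition hadj (X : @surface R) (H : X -> M2) (a : oneform X) : oneform X :=
  fun c p => invmx (H p) *m adj (a c p) *m H p.

(* (1,0)-part B of the Chern connection of (\bar\partial + A, h):
   compatibility with h reads \partial H = A^* H + H B. *)
Definition chern (X : @surface R) (H : X -> M2) (A : oneform X) : oneform X :=
  fun c p => invmx (H p) *m (dz c H p - adj (A c p) *m H p).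

Definition lin (T : Type) (a : oneform T) (k : R[i]) (b : oneform T) : oneform T :=
  fun c p => a c p + k *: b c p.

(* F^{nabla_h} + eps [Phi /\ Phi^*] = 0 and \bar\partial Phi = 0. *)
Definition selfdual (eps : R[i]) (X : @surface R) (H : X -> M2)
    (A Phi : oneform X) : Prop :=
  [/\ form01 A, form10 Phi, tracefree A, tracefree Phi &
   forall c p, @atlas R X c -> dom c p ->
    let B := chern H A in let Phis := hadj H Phi in
    dz c (A c) p - dzb c (B c) p + B c p *m A c p - A c p *m B c p
      + eps *: (Phi c p *m Phis c p - Phis c p *m Phi c p) = 0 /\
    dzb c (Phi c) p + A c p *m Phi c p - Phi c p *m A c p = 0].

(* s is the section l |-> l^-1 Phi + nabla_h + l eps Phi^*, i.e. the class of
   (\bar\partial + l eps Phi^*, Phi + l \partial^h, l), including at l = 0;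
   at l = oo, it is the class of (\partial^h, eps Phi^*, 0) on the conjugate
   surface. *)
Definition represents (eps : R[i]) (X : @surface R) (H : X -> M2)
    (A Phi : oneform X) (s : option R[i] -> set (dh_rep X)) : Prop :=
  [/\ dh_section s,
      forall l, s (Some l) (DHRep true l (lin A (l * eps) (hadj H Phi))
                                         (lin Phi l (chern H A))) &
      s None (DHRep false 0 (fun c p => chern H A (conj_chart c) p)
                            (fun c p => eps *: hadj H Phi (conj_chart c) p))].

Definition is_twistor_line (X : @surface R) (H : X -> M2)
    (s : option R[i] -> set (dh_rep X)) : Prop :=
  exists A Phi, selfdual 1 H A Phi /\ represents 1 H A Phi s.

(* The pullback of \nabla^l = d + A + l eps Phi^* + B + l^-1 Phi
   annihilates the columns of F. *)
Definition flat_frame (eps l : R[i]) (X Xt : @surface R) (pr : Xt -> X)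
    (H : X -> M2) (A Phi : oneform X) (F : Xt -> M2) : Prop :=
  [/\ smooth_map F, forall x, F x \in unitmx &
   forall (ct : chart Xt) (c : chart X) x, atlas ct -> atlas c ->
     dom ct x -> dom c (pr x) ->
     (* dz_c / dz_ct along pr *)
     let k : R[i] := cderiv (coord c \o pr \o param ct) (coord ct x) in
     dz ct F x + k *: (lin (chern H A) l^-1 Phi c (pr x) *m F x) = 0 /\
     dzb ct F x + conjc k *:
       (lin A (l * eps) (hadj H Phi) c (pr x) *m F x) = 0].

(* For maps into H^3 or SU(2) embedded in SL(2,C) as below, harmonicity reads
   d * (f^-1 df) = 0. *)
Definition harmonic (Xt : @surface R) (f : Xt -> M2) : Prop :=
  smooth_map f /\
  forall c x, @atlas R Xt c -> dom c x ->
    dzb c (fun y => invmx (f y) *m dz c f y) x +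
    dz c (fun y => invmx (f y) *m dzb c f y) x = 0.

(* H^3 = SL(2,C)/SU(2) is the space of positive definite hermitian matrices of
   determinant 1, via g SU(2) |-> g g^*.  The metric of curvature -1 is
   |Y|^2 = tr (P^-1 Y P^-1 Y) / 2 at P, which is - det Y: this is the
   hyperboloid in Minkowski space (hermitian matrices, - det). *)
Definition H3 (P : M2) : Prop := posdef P /\ \det P = 1.
Definition H3_normsq (P Y : M2) : R :=
  complex.Re (2^-1 * \tr (invmx P *m Y *m invmx P *m Y)).

(* SU(2) is the unit sphere for |Y|^2 = tr (Y Y^* ) / 2. *)
Definition SU2 (g : M2) : Prop := g *m adj g = 1%:M /\ \det g = 1.
Definition SU2_normsq (_ Y : M2) : R := complex.Re (2^-1 * \tr (Y *m adj Y)).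

Definition equivariant_H3 (X Xt : @surface R) (pr : Xt -> X) (f : Xt -> M2) : Prop :=
  exists rho : (Xt -> Xt) -> M2, forall g, deck pr g ->
    [/\ \det (rho g) = 1,
        forall h, deck pr h -> rho (g \o h) = rho g *m rho h &
        forall x, f (g x) = rho g *m f x *m adj (rho g)].

Definition equivariant_SU2 (X Xt : @surface R) (pr : Xt -> X) (f : Xt -> M2) : Prop :=
  exists rho1 rho2 : (Xt -> Xt) -> M2, forall g, deck pr g ->
    [/\ SU2 (rho1 g), SU2 (rho2 g),
        forall h, deck pr h -> rho1 (g \o h) = rho1 g *m rho1 h /\
                               rho2 (g \o h) = rho2 g *m rho2 h &
        forall x, f (g x) = rho1 g *m f x *m adj (rho2 g)].

(* f is the matrix of h in a flat frame of nabla^1. *)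
Definition twistor_line_of (X Xt : @surface R) (pr : Xt -> X) (H : X -> M2)
    (s : option R[i] -> set (dh_rep X)) (f : Xt -> M2) : Prop :=
  [/\ forall x, H3 (f x), harmonic f, equivariant_H3 pr f &
   exists A Phi F, [/\ selfdual 1 H A Phi, represents 1 H A Phi s,
     flat_frame 1 1 pr H A Phi F &
     forall x, f x = adj (F x) *m H (pr x) *m F x]].

(* In the trivialization of E over Xt by a unitary flat frame F of nabla^1,
   f is the gauge transformation from nabla^1 to nabla^-1: F f is a flat frame
   of nabla^-1. *)
Definition rho_negative_of (X Xt : @surface R) (pr : Xt -> X) (H : X -> M2)
    (s : option R[i] -> set (dh_rep X)) (f : Xt -> M2) : Prop :=
  [/\ forall x, SU2 (f x), harmonic f, equivariant_SU2 pr f &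
   exists A Phi F, [/\ selfdual (-1) H A Phi, represents (-1) H A Phi s,
     flat_frame (-1) 1 pr H A Phi F,
     forall x, adj (F x) *m H (pr x) *m F x = 1%:M &
     flat_frame (-1) (-1) pr H A Phi (fun x => F x *m f x)]].

(* 1/2 \int_D |df|^2, with |Y|^2 = normsq q Y for Y tangent at q. *)
Definition map_energy (normsq : M2 -> M2 -> R) (Xt : @surface R)
    (D : set (borel Xt)) (f : Xt -> M2) : R :=
  2^-1 * Rintegral (area Xt) D (fun x : Xt =>
    (normsq (f x) (px (chart_at x) f x) + normsq (f x) (py (chart_at x) f x))
      / metric (chart_at x) x).

End HarmonicSections.

(* Main.v *)
(** Both energies are integrals of the same density: with [u = tr (Phi Phi^* ) / metric],
    the lift [(\bar\partial + l eps Phi^*, Phi + l \partial^h, l)] gives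
    [E(s) = - eps / pi * \int_X u].  Differentiating [f = F^* H F], respectively comparing
    the flat frames [F] and [F f], shows that [f^-1 \partial f] is conjugate to
    [- 2 Phi], respectively to [2 Phi], whence [|df|^2 = 8 tr (Phi Phi^* )] in either case.

    The integral over the fundamental domain is carried to [X] without a change of
    variables for Lebesgue measure.  Where [df <> 0] the projection [pr] has nonzero
    derivative, so charts of [X] lift to charts of [Xt] by maximality of the atlas,
    and in corresponding charts both areas are integrals over the same subset of the plane.
    Where [df = 0], either [Phi = 0] or the derivative of [pr] vanishes, and the image
    of the latter set is null by Sard's argument; no theorem to the effect that an
    injective holomorphic map has nonzero derivative is needed. *)
Require Import Defs.
From HB Require Import structures.
From mathcomp Require Import all_boot all_order all_algebra.
From mathcomp Require Import all_classical all_reals all_analysis.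
From mathcomp Require Import complex.
From mathcomp Require Import measurable_realfun.
From mathcomp Require Import ring lra.
Require Import Defs.
Set Implicit Arguments.
Unset Strict Implicit.
Unset Printing Implicit Defensive.
Import Order.TTheory GRing.Theory Num.Theory.
Import numFieldNormedType.Exports.
Local Open Scope classical_set_scope.
Local Open Scope ring_scope.
Local Open Scope complex_scope.

(** * Integrals against densities and null images *)

(** The factor 8 arises differently for the two targets. In [H3] only the mixed trace of f^-1
    \partial f and f^-1 \bar\partial f survives, with weight 2, and each factor carries a 2. In
    [SU2] the squared norms of \partial f and \bar\partial f add, 4 each. With the 1/2 in
    [map_energy] both energies are 4 \int u, which turns 1 / pi into 1 / (4 pi). The sign comes from
    [eps] alone.

    The obstacle is the domain of integration: D is merely a Borel set of representatives, and
    [area] is described only on sets inside one chart domain. So the transfer is proved for Borel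
    subsets of a single sheet and then summed over countably many sheets. All these are identities
    in [0, +oo] between integrals of non-negative densities, and [fine] is applied to both sides
    afterwards. *)

Section Density.
Local Open Scope ereal_scope.
Context d d' (T : measurableType d) (T' : measurableType d') (R : realType).
Variables (mu : {measure set T -> \bar R}) (nu : {measure set T' -> \bar R}).
Variables (E : set T) (S : set T') (p : T -> T') (g : T -> R).
Hypotheses (mE : measurable E) (mS : measurable S) (mg : measurable_fun E g)
  (mp : measurable_fun E p) (ES : forall x, E x -> S (p x))
  (g0 : forall x, E x -> (0 <= g x)%R)
  (nuE : forall A, measurable A -> A `<=` S ->
     nu A = \int[mu]_(x in E `&` p @^-1` A) (g x)%:E).

Import HBNNSimple.

(** [nuE] is the case of indicator functions; linearity gives simple functions and monotone
    convergence gives [f]. Only the values of [nu] on subsets of [S] are prescribed, which fits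
    [area], known inside one chart domain at a time. *)
Lemma ge0_integral_density (f : T' -> \bar R) :
  (forall y, S y -> 0 <= f y) -> measurable_fun S f ->
  \int[nu]_(y in S) f y = \int[mu]_(x in E) (f (p x) * (g x)%:E).
Proof.
move=> f0 mf; pose h := nnsfun_approx mS mf.
have mhr n r : measurable (h n @^-1` [set r]) by rewrite -[X in measurable X]setTI; apply: measurable_funP.
have mh n : measurable_fun S (EFin \o h n).
  by apply/measurable_funTS/measurable_EFinP; exact: measurable_funP.
have mhp n : measurable_fun E (EFin \o h n \o p).
  apply/(measurable_comp mS _ (mh n) mp).
  by move=> _ [x Ex <-]; exact: ES.
have mge : measurable_fun E (EFin \o g) by exact/measurable_EFinP.
have hf x : S x -> EFin \o h^~ x @ \oo --> f x by move=> Ex; exact: cvg_nnsfun_approx.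
have hnd x a b : (a <= b)%N -> (h a x <= h b x)%R.
  by move=> ab; exact/lefP/nd_nnsfun_approx.
transitivity (lim (\int[nu]_(x in S) (EFin \o h n) x @[n --> \oo])).
  rewrite -monotone_convergence//.
  - by apply: eq_integral => x /[!inE] Ex; apply/esym/cvg_lim => //; exact: hf.
  - by move=> n x Ex /=; rewrite lee_fin.
  - by move=> x Ex a b ab; rewrite lee_fin hnd.
transitivity (lim (\int[mu]_(x in E) ((EFin \o h n \o p) \* (EFin \o g)) x @[n --> \oo])); last first.
  rewrite -monotone_convergence//.
  - apply: eq_integral => x /[!inE] Ex; apply/cvg_lim => //.
    by apply: cvgeZr => //; exact/hf/ES.
  - by move=> n; apply/emeasurable_funM.
  - by move=> n x Ex /=; rewrite mule_ge0 ?lee_fin ?g0.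
  - by move=> x Ex a b ab /=; apply: lee_wpmul2r; rewrite lee_fin ?g0 ?hnd.
suff suf n : \int[mu]_(x in E) ((EFin \o h n \o p) x * (EFin \o g) x) =
    \int[nu]_(x in S) (EFin \o h n) x by under eq_fun do rewrite -suf.
have mind m r : measurable_fun S (fun x => (r * \1_(h m @^-1` [set r]) x)%:E).
  by apply: (measurable_comp measurableT) => //; exact: measurable_funM.
have mindp m r : measurable_fun E (fun x => (r * \1_(h m @^-1` [set r]) (p x))%:E).
  apply/(measurable_comp mS _ (mind m r) mp).
  by move=> _ [x Ex <-]; exact: ES.
transitivity (\int[nu]_(x in S)
   (\sum_(y \in range (h n)) (y * \1_(h n @^-1` [set y]) x)%:E)); last first.
  by apply: eq_integral => t tE; rewrite /= fimfunE -fsumEFin.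
rewrite ge0_integral_fsum//; last by move=> m y Ey; exact: nnfun_muleindic_ge0.
transitivity (\int[mu]_(x in E) (\sum_(y \in range (h n))
    (y * \1_(h n @^-1` [set y]) (p x))%:E * (g x)%:E)).
  under [RHS]eq_integral => x xE.
    rewrite -ge0_mule_fsuml => [|y]; last exact: nnfun_muleindic_ge0.
    rewrite fsumEFin // -(fimfunE _ (p x)); over.
  by [].
rewrite ge0_integral_fsum//; last 2 first.
  - by move=> y; apply: emeasurable_funM => //; exact: mindp.
  - by move=> y x Ex; apply: mule_ge0; [exact: nnfun_muleindic_ge0 | rewrite lee_fin g0].
apply: eq_fsbigr => r rhn.
have r0 : (0 <= r)%R by move: rhn; rewrite inE => -[t _ <-].
under [RHS]eq_integral do rewrite EFinM.
rewrite integralZl_indic_nnsfun => //.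
under eq_integral do rewrite EFinM -muleA.
have mA : measurable (E `&` p @^-1` (h n @^-1` [set r])) by exact: mp.
rewrite ge0_integralZl//.
- under eq_integral do rewrite muleC.
  rewrite (eq_integral ((EFin \o g) \_ (p @^-1` (h n @^-1` [set r])))); last first.
    by move=> x xE; rewrite epatch_indic.
  rewrite -integral_mkcondr integral_indic// setIC nuE//; last exact: measurableI.
  congr (_ * integral _ _ _); rewrite eqEsubset; split=> x /= [Ex xr]; split => //.
    by split => //; exact: ES.
  by case: xr.
- apply: emeasurable_funM => //; apply/measurable_EFinP.
  apply/(measurable_comp mS _ _ mp); last exact: measurable_indic.
  by move=> _ [x Ex <-]; exact: ES.
- by move=> t Et; rewrite mule_ge0 ?lee_fin ?g0.
Qed.
End Density.

Section NullImage.
Context {R : realType}.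
Notation plane2 := (measurableTypeR R * measurableTypeR R)%type.
Let leb2 : {measure set plane2 -> \bar R} := (lebesgue_measure \x lebesgue_measure)%E.

Definition square (p : R * R) (r : R) : set plane2 :=
  `[p.1 - r, p.1 + r]%classic `*` `[p.2 - r, p.2 + r]%classic.

Lemma measurable_square p r : measurable (square p r).
Proof. by apply: measurableX; exact: measurable_itv. Qed.

Lemma leb2_square p r : 0 <= r -> leb2 (square p r) = ((r *+ 2) ^+ 2)%:E.
Proof.
move=> r0; rewrite expr2 [LHS]product_measure1E//.
have E (a : R) : lebesgue_measure (`[a - r, a + r]%classic : set (measurableTypeR R)) = (r *+ 2)%:E.
  rewrite lebesgue_measure_itv/= lte_fin.
  case: ltP => [_|h]; first by congr (_%:E); ring.
  (* Here [h] and [r0] force [r] = 0, and the one-point interval has length 0. *)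
  congr (_%:E); lra.
rewrite EFinM; congr mule; exact: E.
Qed.

Lemma square_norm p q r : `|p - q| <= r -> square q r p.
Proof.
by rewrite prod_normE/= ge_max /square/= !in_itv/= !ler_distl => /andP[-> ->].
Qed.

(** The box of radius [M] is cut into (2 M n)^2 cells of side 1 / n, and the image of each cell lies
    in a square of side 2 e / n. The total area (4 M e)^2 no longer involves [n], so the mesh may
    tend to 0 while [e] stays fixed. *)
Lemma grid_cover (f : R * R -> R * R) (Z : set (R * R)) (M n : nat) (e : R) :
  0 <= e -> (0 < n)%N ->
  (forall z, Z z -> `|z| < M%:R) ->
  (forall z w, Z z -> Z w -> `|w - z| <= n%:R^-1 -> `|f w - f z| <= e / n%:R) ->
  exists C : set plane2, [/\ measurable C, f @` Z `<=` C &
    (leb2 C <= ((4 * M%:R * e) ^+ 2)%:E)%E].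
Proof.
move=> e0 n0 ZM Zf; pose m := (2 * M * n)%N.
have nR : 0 < n%:R :> R by rewrite ltr0n.
pose idx (a : R) := Num.truncn ((a + M%:R) * n%:R).
pose z i j : R * R := xget (0, 0) [set z | [/\ Z z, idx z.1 = i & idx z.2 = j]].
pose S i j := square (f (z i j)) (e / n%:R).
have mS i j : measurable (S i j) by exact: measurable_square.
pose C := \big[setU/set0]_(i < m) \big[setU/set0]_(j < m) S i j.
have mrow i : measurable (\big[setU/set0]_(j < m) S i j).
  by apply: bigsetU_measurable => j _.
exists C; split.
- by apply: bigsetU_measurable.
- move=> _ [w Zw <-].
  have idxm (a : R) : `|a| < M%:R -> (idx a < m)%N /\ (idx a)%:R <= (a + M%:R) * n%:R < (idx a).+1%:R.
    rewrite ltr_norml => /andP[a1 a2].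
    have h0 : 0 <= (a + M%:R) * n%:R by apply: mulr_ge0; lra.
    split; last exact: truncn_itv.
    rewrite /idx truncn_lt_nat// /m 2!natrM ltr_pM2r// mulr_natl; lra.
  have := ZM _ Zw; rewrite prod_normE/= gt_max => /andP[/idxm[i1 i2] /idxm[j1 j2]].
  rewrite /C -(bigcup_mkord _ (fun i => \big[setU/set0]_(j < m) S i j)); exists (idx w.1) => //.
  rewrite -(bigcup_mkord _ (S _)); exists (idx w.2) => //.
  have [Zz zi zj] : [set z | [/\ Z z, idx z.1 = idx w.1 & idx z.2 = idx w.2]] (z (idx w.1) (idx w.2)).
    by apply: (@xgetI _ (0,0) _ w).
  apply/square_norm/Zf => //.
  have := ZM _ Zz; rewrite prod_normE/= gt_max => /andP[/idxm[_ +] /idxm[_ +]].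
  rewrite zi zj => i3 j3.
  have D (a b : R) (k : nat) : k%:R <= (a + M%:R) * n%:R < k.+1%:R ->
     k%:R <= (b + M%:R) * n%:R < k.+1%:R -> `|a - b| <= n%:R^-1.
    move=> /andP[a1 a2] /andP[b1 b2]; rewrite -[leRHS]mul1r ler_pdivlMr//.
    rewrite -[X in _ * X <= _](gtr0_norm nR) -normrM ler_norml.
    rewrite -natr1 in a2 b2; apply/andP; split; lra.
  by rewrite prod_normE/= ge_max; apply/andP; split; [apply: D i2 i3|apply: D j2 j3].
- have rowle i : (leb2 (\big[setU/set0]_(j < m) S i j) <= ((e / n%:R *+ 2) ^+ 2 *+ m)%:E)%E.
    apply: le_trans (Boole_inequality leb2 _) _ => //.
    rewrite (eq_bigr (fun=> ((e / n%:R *+ 2) ^+ 2)%:E)).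
      by rewrite sumEFin sumr_const card_ord.
    by move=> j _; apply: leb2_square; rewrite divr_ge0.
  apply: le_trans.
    exact: (@Boole_inequality _ _ _ leb2 (fun i => \big[setU/set0]_(j < m) S i j)).
  apply: (@le_trans _ _ (\sum_(i < m) ((e / n%:R *+ 2) ^+ 2 *+ m)%:E)%E).
    by apply: lee_sum => i _; exact: rowle.
  rewrite sumEFin sumr_const card_ord lee_fin -[leLHS]mulr_natr -(mulr_natr _ m) /m !natrM.
  rewrite le_eqVlt; apply/orP; left; apply/eqP; field.
  by rewrite gt_eqF.
Qed.

(** Sard's argument in the case of zero derivative: in a bounded piece, the points where flatness
    with constant [e] already holds at scale 1 / (n + 1) have an image covered by area of order e^2,
    uniformly in [n]. Then [n] tends to infinity and [e] to 0. *)
Lemma flat_image_null (f : R * R -> R * R) (Z : set (R * R)) :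
  (forall z, Z z -> forall e, 0 < e -> exists2 d, 0 < d &
     forall w, Z w -> `|w - z| <= d -> `|f w - f z| <= e * `|w - z|) ->
  leb2.-negligible (f @` Z).
Proof.
move=> flat.
have bounded (M : nat) : leb2.-negligible (f @` (Z `&` [set z | `|z| < M%:R])).
  pose ZM := Z `&` [set z : R * R | `|z| < M%:R].
  have cover (e : R) : 0 < e -> exists L : set plane2, [/\ measurable L, f @` ZM `<=` L &
      (leb2 L <= ((4 * M%:R * e) ^+ 2)%:E)%E].
    move=> e0.
    pose Zn n := [set z | ZM z /\ forall w, ZM w -> `|w - z| <= n.+1%:R^-1 -> `|f w - f z| <= e * `|w - z|].
    have H n : exists C : set plane2, [/\ measurable C, f @` Zn n `<=` C &
        (leb2 C <= ((4 * M%:R * e) ^+ 2)%:E)%E].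
      apply: (@grid_cover _ _ M n.+1) => //; first exact: ltW.
        by move=> z [[]].
      move=> z w [Zz H] [Zw _] wz; apply: le_trans (H _ Zw wz) _.
      by rewrite ler_wpM2l// ltW.
    have [C HC] := choice H.
    (* The sets [Zn n] may fail to be measurable and the covers [C n] need not increase with [n].
       Their lower limit, the union of the increasing [B N], keeps the bound and contains the image,
       since each point of [ZM] lies in [Zn n] for all large [n]. *)
    pose B N := \bigcap_(n in [set n | (N <= n)%N]) C n.
    have mC n : measurable (C n) by case: (HC n).
    have mB N : measurable (B N) by apply: bigcap_measurable => // ; exists N => /=.
    have mBU : measurable (\bigcup_N B N) by exact: bigcup_measurable.
    exists (\bigcup_N B N); split => //.
    - move=> _ [z Zz <-].
      have [d d0 hd] := flat z Zz.1 e e0.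
      have [N hN] : exists N : nat, N.+1%:R^-1 < d.
        exists (Num.truncn d^-1); rewrite invf_plt ?posrE//; exact: truncnS_gt.
      exists N => // n /= Nn; case: (HC n) => _ + _; apply; exists z => //; split => // w Zw wz.
      apply: hd => //; first by case: Zw.
      apply: le_trans wz _; apply: le_trans (ltW hN).
      by rewrite lef_pV2 ?posrE// ler_nat ltnS.
    - apply: (cvge_to_le (nondecreasing_cvg_mu (mu := leb2) mB mBU _)).
        move=> a b ab; apply/subsetPset => v Bv n /= bn.
        by apply: Bv => /=; exact: leq_trans bn.
      near=> n; case: (HC n) => _ _; apply: le_trans => /=.
      apply: le_measure; rewrite ?inE//.
      by move=> v; apply => /=.
  have [L HL] := choice (fun m : nat => cover m.+1%:R^-1 ltac:(by [])).
  have mL m : measurable (L m) by case: (HL m).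
  exists (\bigcap_m L m); split.
  - exact: bigcap_measurable.
  - apply/eqP; rewrite eq_le measure_ge0 andbT.
    apply/lee_addgt0Pr => /= e e0; rewrite add0e.
    (* This makes (4 M)^2 < e (m + 1), hence (4 M / (m + 1))^2 <= e. *)
    pose m := Num.truncn ((4 * M%:R) ^+ 2 / e).
    apply: (@le_trans _ _ (leb2 (L m))).
      apply: le_measure; rewrite ?inE//; first exact: bigcap_measurable.
      by move=> v; apply.
    case: (HL m) => _ _ /le_trans; apply; rewrite lee_fin.
    have : (4 * M%:R) ^+ 2 / e < m.+1%:R by exact: truncnS_gt.
    rewrite ltr_pdivrMr// => h.
    rewrite exprMn exprVn ler_pdivrMr ?exprn_gt0//.
    apply: (le_trans (ltW h)); rewrite mulrC; apply: ler_wpM2l; first exact: ltW.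
    by rewrite -natrX ler_nat expnS leq_pmulr ?expn_gt0.
  - by move=> y [z Zz <-] m _; case: (HL m) => _ + _; apply; exists z.
apply: (negligibleS _ (negligible_bigcup bounded)) => _ [z Zz <-].
exists (Num.truncn `|z|).+1 => //; exists z => //; split => //=.
exact: truncnS_gt.
Unshelve. all: by end_near. Qed.
End NullImage.

(** * Charts, area and coordinates *)

Section Topology.

Lemma near_of_open (T : topologicalType) (A : set T) (x : T) (P : T -> Prop) :
  open A -> A x -> (forall y, A y -> P y) -> \forall y \near x, P y.
Proof. by move=> oA Ax h; apply: filterS (open_nbhs_nbhs (conj oA Ax)). Qed.

Lemma within_continuousP (T U : topologicalType) (A : set T) (f : T -> U) : open A ->
  {within A, continuous f} <-> forall x, A x -> {for x, continuous f}.
Proof.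
move=> oA; rewrite continuous_open_subspace//; split=> [h x Ax|h x].
  by apply: h; rewrite inE.
by rewrite inE => Ax; apply: h.
Qed.

Lemma open_within_preimage (T U : topologicalType) (A : set T) (B : set U) (f : T -> U) :
  open A -> {within A, continuous f} -> open B -> open (A `&` f @^-1` B).
Proof.
move=> oA /(within_continuousP _ oA) cf oB; rewrite openE => x [Ax Bfx].
apply: filterI; first exact: open_nbhs_nbhs.
by apply: cf => //; exact: open_nbhs_nbhs.
Qed.

Lemma borel_measurable_fun d (S : measurableType d) (T : ptopologicalType) (E : set S)
    (f : S -> borel T) :
  (forall O : set T, open O -> measurable (E `&` f @^-1` O)) -> measurable_fun E f.
Proof.
move=> h; refine (@measurability _ _ S (borel T) E f (@open T) erefl _).
by move=> _ [B oB <-]; exact: h.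
Qed.

Lemma open_borel (T : ptopologicalType) (O : set T) : open O -> measurable (O : set (borel T)).
Proof. exact: sub_sigma_algebra. Qed.

Lemma within_continuous_borel (T U : ptopologicalType) (A : set T) (f : T -> U) :
  open A -> {within A, continuous f} -> @measurable_fun _ _ (borel T) (borel U) A f.
Proof.
move=> oA cf; apply: borel_measurable_fun => O oO.
by apply: open_borel; exact: open_within_preimage.
Qed.

Lemma within_continuous_borelR (R : realType) (T : ptopologicalType) (A : set T) (f : T -> R) :
  open A -> {within A, continuous f} -> @measurable_fun _ _ (borel T) (measurableTypeR R) A f.
Proof.
move=> oA cf; apply: (@measurability _ _ _ _ _ _ _ (RGenOpens.measurableE R)).
move=> _ [_ [a [b ->] <-]]; apply: open_borel.
by apply: open_within_preimage => //; exact: interval_open.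
Qed.

End Topology.

Section Plane.
Context {R : realType}.
Notation plane2 := (measurableTypeR R * measurableTypeR R)%type.

(** The product sigma-algebra is generated by rectangles, so [U] is written as the countable union
    of the squares inside it with rational centre and radius 1 / (n + 1). *)
Lemma open_measurable2 (U : set (R * R)) : open U -> measurable (U : set plane2).
Proof.
move=> oU; pose I := (rat * rat * nat)%type.
pose sq (i : I) := square (ratr i.1.1, ratr i.1.2) (i.2.+1%:R^-1 : R).
pose F (i : I) : set plane2 := if pselect (sq i `<=` U) then sq i else set0.
have -> : U = \bigcup_i F i.
  rewrite eqEsubset; split => v; last first.
    by move=> [i _]; rewrite /F; case: pselect => // h; exact: h.
  move=> Uv; have : nbhs v U by exact: open_nbhs_nbhs.
  move=> /nbhs_ballP [e /= e0 be].
  pose n := Num.truncn (2 / e); pose r : R := n.+1%:R^-1.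
  have r0 : 0 < r by rewrite invr_gt0.
  have re : r + r < e.
    have : 2 / e < n.+1%:R by exact: truncnS_gt.
    rewrite ltr_pdivrMr// => h; rewrite -mulr2n -mulr_natl ltr_pdivrMr//.
    by rewrite mulrC.
  have [p hp] : exists p : rat, ratr p \in `]v.1 - r, v.1 + r[ by apply: rat_in_itvoo; lra.
  have [q hq] : exists q : rat, ratr q \in `]v.2 - r, v.2 + r[ by apply: rat_in_itvoo; lra.
  rewrite !in_itv/= in hp hq.
  exists (p, q, n) => //; rewrite /F; case: pselect => [h|].
    by rewrite /sq /square /= !in_itv/= -/r; split; lra.
  case=> w; rewrite /sq /square /= !in_itv/= -/r => -[/= h1 h2].
  by apply: be; split; rewrite /ball/= ltr_norml; lra.
apply: countable_bigcupT_measurable.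
  exact: (@countableP I).
move=> i; rewrite /F; case: pselect => h; [exact: measurable_square|exact: measurable0].
Qed.

(** The order on [R[i]] compares only numbers with equal imaginary part, so the radii occurring in
    its topology are real. *)
Lemma ltc_pos (e : R[i]) : 0 < e -> exists2 r : R, 0 < r & e = r%:C.
Proof. by case: e => a b; rewrite ltcE/= => /andP[/eqP-> a0]; exists a. Qed.

Lemma normc_le_ReIm (z : R[i]) : `|z| <= (`|complex.Re z| + `|complex.Im z|)%:C.
Proof.
case: z => a b /=; rewrite normc_def/= lecR -(@ger0_norm _ (`|a| + `|b|)) ?addr_ge0//.
rewrite -sqrtr_sqr ler_wsqrtr// sqrrD !real_normK ?num_real//.
by rewrite -addrA lerD2l lerDr mulrn_wge0// mulr_ge0.
Qed.

Lemma normc_ge_Im (z : R[i]) : `|complex.Im z|%:C <= `|z|.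
Proof.
case: z => a b /=; rewrite normc_def/= lecR -sqrtr_sqr ler_wsqrtr//.
by rewrite lerDr sqr_ge0.
Qed.

Lemma continuous_cplx : continuous (@cplx R).
Proof.
move=> v; apply/(@cvgrPdist_le _ (R[i])^o) => /= e /ltc_pos[r r0 ->].
near=> w.
apply: le_trans (normc_le_ReIm _) _; rewrite lecR /=.
have h : `|v - w| <= r / 2.
  by near: w; apply: cvgr_dist_le => //; rewrite divr_gt0.
rewrite prod_normE/= ge_max in h; case/andP: h => h1 h2.
by rewrite (splitr r) lerD.
Unshelve. all: by end_near. Qed.

Lemma continuous_Re : continuous (@complex.Re R : (R[i])^o -> R).
Proof.
move=> v; apply/(@cvgrPdist_le R R _ (nbhs v) (nbhs_filter v)) => /= e e0; near=> w.
rewrite -raddfB -lecR; apply: le_trans (normc_ge_Re _) _.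
by near: w; apply: (@cvgr_dist_le _ (R[i])^o) => //; rewrite ltcR.
Unshelve. all: by end_near. Qed.

Lemma continuous_Im : continuous (@complex.Im R : (R[i])^o -> R).
Proof.
move=> v; apply/(@cvgrPdist_le R R _ (nbhs v) (nbhs_filter v)) => /= e e0; near=> w.
rewrite -raddfB -lecR; apply: le_trans (normc_ge_Im _) _.
by near: w; apply: (@cvgr_dist_le _ (R[i])^o) => //; rewrite ltcR.
Unshelve. all: by end_near. Qed.

Lemma continuous_plane : continuous (@plane R).
Proof.
move=> v; exact: (@cvg_pair _ _ _ _ _ _ (nbhs_filter v) _ _ _ _ (@continuous_Re v) (@continuous_Im v)).
Qed.

Lemma norm_plane_le (a : R[i]) (r : R) : `|a| <= r%:C -> `|plane a| <= r.
Proof.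
move=> ar; rewrite prod_normE/= ge_max -2!lecR.
by rewrite (le_trans (normc_ge_Re _))//= (le_trans (normc_ge_Im _)).
Qed.

Lemma cplxK : cancel (@cplx R) plane. Proof. by case. Qed.
Lemma planeK : cancel plane (@cplx R). Proof. by case. Qed.

End Plane.

Section Charts.
Context {R : realType} (X : @surface R).
Notation plane2 := (measurableTypeR R * measurableTypeR R)%type.
Let leb2 : {measure set plane2 -> \bar R} := (lebesgue_measure \x lebesgue_measure)%E.
Hypothesis hX : riemann_surface X.
Implicit Types c : @chart R X.

Lemma atlas_valid c : atlas c -> valid_chart c.
Proof. by move: hX => [[_ _ _ [h _ _ _]] _]; exact: h. Qed.

Lemma open_dom c : atlas c -> open (dom c).
Proof. by case/atlas_valid. Qed.

Lemma paramK c p : atlas c -> dom c p -> param c (coord c p) = p.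
Proof. by move=> /atlas_valid[_ _ h _ _]; exact: h. Qed.

Lemma param_plane c p : atlas c -> dom c p -> param c (cplx (plane (coord c p))) = p.
Proof. by move=> ? ?; rewrite planeK paramK. Qed.

Lemma open_image2 c : atlas c -> open (image2_of c).
Proof.
case/atlas_valid => _ oi _ _ _.
by apply: open_comp => // v _; exact: continuous_cplx.
Qed.

Lemma image2_coord c p : dom c p -> image2_of c (plane (coord c p)).
Proof. by move=> cp; rewrite /image2_of /= planeK; exists p. Qed.

Lemma image2P c v : atlas c -> image2_of c v ->
  dom c (param c (cplx v)) /\ plane (coord c (param c (cplx v))) = v.
Proof. by move=> ac [p cp e]; rewrite -e paramK// e cplxK. Qed.

Lemma continuous_chart2 c : atlas c -> {within dom c, continuous (plane \o coord c)}.
Proof.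
move=> /atlas_valid[od _ _ /(within_continuousP _ od) h _].
apply/(within_continuousP _ od) => p cp.
by apply: continuous_comp; [exact: h|exact: continuous_plane].
Qed.

Lemma continuous_param2 c : atlas c -> {within image2_of c, continuous (param c \o cplx)}.
Proof.
move=> ac; have oi := open_image2 ac; case/atlas_valid : ac => _ oi' _ _ h.
apply/(within_continuousP _ oi) => v iv.
apply: continuous_comp; first exact: continuous_cplx.
by move/(within_continuousP _ oi') : h; apply.
Qed.

Definition chart_set (c : @chart R X) (S : set X) : set plane2 := [set v | (coord c @` S) (cplx v)].

(** Exchanges an image under [coord] for a preimage under [param], to which measurability of maps
    applies. *)
Lemma chart_setE c S : atlas c -> S `<=` dom c ->
  chart_set c S = image2_of c `&` (param c \o cplx) @^-1` S.
Proof.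
move=> ac Sc; rewrite eqEsubset; split => v.
  move=> [p Sp e]; split; first by exists p => //; exact: Sc.
  by rewrite /= -e paramK//; exact: Sc.
by move=> [/(image2P ac)[_ e] Sv]; exists (param c (cplx v)) => //; rewrite -[in RHS]e planeK.
Qed.

Lemma measurable_param2 c : atlas c ->
  @measurable_fun _ _ plane2 (borel X) (image2_of c) (param c \o cplx).
Proof.
move=> ac; apply: borel_measurable_fun => B oB; apply: open_measurable2.
by apply: open_within_preimage => //; [exact: open_image2|exact: continuous_param2].
Qed.

Lemma measurable_chart_set c (S : set (borel X)) : atlas c -> measurable S -> S `<=` dom c ->
  measurable (chart_set c S).
Proof.
move=> ac mS Sc; rewrite chart_setE//; apply: measurable_param2 => //.
by apply: open_measurable2; exact: open_image2.
Qed.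

Lemma area_chart c (S : set (borel X)) : atlas c -> measurable S -> S `<=` dom c ->
  area X S = (\int[leb2]_(v in chart_set c S) (metric c (param c (cplx v)))%:E)%E.
Proof. by move: hX => [_ [_ _ _ h]] ac mS Sc; exact: h. Qed.

Lemma metric_gt0 c p : atlas c -> dom c p -> 0 < metric c p.
Proof. by move: hX => [_ [h _ _ _]]; exact: h. Qed.

Lemma metric_continuous c : atlas c ->
  {within image2_of c, continuous (metric c \o param c \o cplx)}.
Proof. by move: hX => [_ [_ h _ _]] ac; have [] := h c ac 0. Qed.

Lemma chart_set_sub c S : atlas c -> S `<=` dom c -> chart_set c S `<=` image2_of c.
Proof. by move=> ac Sc; rewrite chart_setE//; exact: subIsetl. Qed.

Lemma measurable_image2 c : atlas c -> measurable (image2_of c : set plane2).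
Proof. by move=> ac; apply: open_measurable2; exact: open_image2. Qed.

Lemma measurable_metric c : atlas c ->
  @measurable_fun _ _ plane2 (measurableTypeR R) (image2_of c) (metric c \o param c \o cplx).
Proof.
move=> ac; apply: (@measurability _ _ _ _ _ _ _ (RGenOpens.measurableE R)).
move=> _ [_ [a [b ->] <-]]; apply: open_measurable2.
apply: open_within_preimage; [exact: open_image2|exact: metric_continuous|exact: interval_open].
Qed.

(** The area axiom prescribes the measure of sets in a chart; this is its extension to non-negative
    functions, with [metric c] as density. *)
Lemma integral_chart c (S : set (borel X)) (f : borel X -> \bar R) :
  atlas c -> measurable S -> S `<=` dom c ->
  (forall x, S x -> (0 <= f x)%E) -> measurable_fun S f ->
  (\int[area X]_(x in S) f x =
   \int[leb2]_(v in chart_set c S)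
     (f (param c (cplx v)) * (metric c (param c (cplx v)))%:E))%E.
Proof.
move=> ac mS Sc f0 mf.
have mC := measurable_chart_set ac mS Sc.
have Ci := chart_set_sub ac Sc.
have mi := measurable_image2 ac.
apply: (@ge0_integral_density _ _ plane2 (borel X) R leb2 (area X) (chart_set c S) S
  (param c \o cplx) (fun v => metric c (param c (cplx v)))) => //.
- exact: (measurable_funS mi Ci (measurable_metric ac)).
- exact: (measurable_funS mi Ci (measurable_param2 ac)).
- by move=> v; rewrite chart_setE// => -[].
- by move=> v /Ci/(image2P ac)[+ _] => /(metric_gt0 ac)/ltW.
- move=> A mA AS; rewrite (area_chart ac mA); last exact: subset_trans AS Sc.
  congr (integral _ _ _); rewrite !chart_setE//; last exact: subset_trans AS Sc.
  rewrite -setIA; congr (_ `&` _).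
  by rewrite eqEsubset; split => v /= => [h|[]//]; split => //; exact: AS.
Qed.

End Charts.

(** * Complex derivatives *)

Section ComplexDerivative.
Context {R : realType}.
Notation C := (R[i])^o.
Implicit Types f : C -> C.

(** Multiplying the difference quotient by its denominator makes the estimate trivial at z = w, so a
    full neighbourhood replaces the punctured one. *)
Lemma cderivP f (w : C) (k : R[i]) : (derivable f w 1 /\ cderiv f w = k) <->
  forall e : R[i], 0 < e -> \forall z \near w, `|f z - f w - k * (z - w)| <= e * `|z - w|.
Proof.
have E : cderiv f w = 'D_1 f w by rewrite /cderiv derive1E.
have key e : 0 < e ->
  (\forall z \near w, `|f z - f w - k * (z - w)| <= e * `|z - w|) <->
  (\forall h \near (0 : C)^', `|k - h^-1 *: ((f \o shift w) (h *: (1:C)) - f w)| <= e).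
  move=> e0; rewrite near_withinE (near_shift (0 : C) w); split; apply: filterS => h /=.
    rewrite subr0 addrK => H h0.
    rewrite [h *: _]mulr1 -(@ler_pM2l _ `|h|) ?normr_gt0// -normrM mulrBr.
    rewrite [h * (_ *: _)]mulrA divff// mul1r [leLHS]distrC [h * k]mulrC [leRHS]mulrC.
    exact: H.
  rewrite subr0 addrK => H; have [->|h0] := eqVneq h 0.
    by rewrite add0r subrr mulr0 subr0 normr0 mulr0.
  have := H h0; rewrite [h *: _]mulr1 -(@ler_pM2l _ `|h|) ?normr_gt0// -normrM mulrBr.
  by rewrite [h * (_ *: _)]mulrA divff// mul1r [leLHS]distrC [h * k]mulrC [leRHS]mulrC.
rewrite E; split.
  move=> [df dk] e e0; apply: (proj2 (key e e0)); move: df; rewrite /derivable -dk => df.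
  by move/(@cvgrPdist_le C C) : df => /(_ e e0).
move=> H; have cv : h^-1 *: ((f \o shift w) (h *: (1:C)) - f w) @[h --> (0:C)^'] --> (k : C).
  by apply/(@cvgrPdist_le C C) => /= e e0; apply: (proj1 (key e e0)); exact: H.
split; first by apply/cvg_ex; exists k.
exact: cvg_lim cv.
Qed.

Lemma near_cderiv f g (w : C) : (\forall z \near w, f z = g z) -> cderiv f w = cderiv g w.
Proof.
move=> fg; have E h : cderiv h w = 'D_1 h w by rewrite /cderiv derive1E.
have H := @near_eq_derive _ C C f g w 1 fg.
by rewrite !E; exact: H.
Qed.

(** Carathéodory's form of the derivative, by a slope function continuous at [w]. Slopes multiply
    under composition and invert under inversion, which yields [cderiv_comp] and
    [derivable_inverse]. *)
Lemma caratheodory f (w : C) (k : R[i]) : (derivable f w 1 /\ cderiv f w = k) <->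
  exists s : C -> C, [/\ \forall z \near w, f z - f w = s z * (z - w), s w = k &
    {for w, continuous s}].
Proof.
split=> [/cderivP H|[s [fs sw cs]]].
  exists (fun z => if z == w then k else (f z - f w) / (z - w)); split.
  - apply: (@nearW _ (nbhs w) _ (nbhs_filter w)) => z; case: eqVneq => [->|zw]; first by rewrite !subrr mulr0.
    by rewrite divfK// subr_eq0.
  - by rewrite eqxx.
  - apply/(@cvgrPdist_le C C _ (nbhs w) (nbhs_filter w)) => /= e e0.
    rewrite eqxx; apply: filterS (H e e0) => z.
    case: eqVneq => [-> _|zw h]; first by rewrite subrr normr0 ltW.
    have n0 : 0 < `|z - w| by rewrite normr_gt0 subr_eq0.
    rewrite distrC -(ler_pM2r n0) -normrM mulrBl divfK// subr_eq0//.
apply/cderivP => e e0.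
move/(@cvgrPdist_le C C _ (nbhs w) (nbhs_filter w)) : cs => /(_ e e0); apply: filterS2 fs => z -> h.
by rewrite -mulrBl normrM ler_wpM2r// distrC -sw.
Qed.

Lemma derivable_continuous_at f (w : C) : derivable f w 1 -> {for w, continuous f}.
Proof.
move=> df; exact: (differentiable_continuous (proj1 (@derivable1_diffP _ C f w) df)).
Qed.

Lemma cderiv_comp f g (w : C) : derivable f w 1 -> derivable g (f w) 1 ->
  derivable (g \o f) w 1 /\ cderiv (g \o f) w = cderiv g (f w) * cderiv f w.
Proof.
move=> df dg; have cf := derivable_continuous_at df.
have [s [fs sw cs]] := proj1 (caratheodory f w (cderiv f w)) (conj df erefl).
have [t [gt tw ct]] := proj1 (caratheodory g (f w) (cderiv g (f w))) (conj dg erefl).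
apply/caratheodory; exists (fun z => t (f z) * s z); split.
- by apply: filterS2 fs (cf _ gt) => z e /= ->; rewrite e mulrA.
- by rewrite sw tw.
- exact: (@cvgM C _ (nbhs w) (nbhs_filter w) _ _ _ _ (@continuous_comp _ _ _ f t w cf ct) cs).
Qed.

(* [g] is a continuous right inverse of [f]: [f' <> 0] is needed only at [w]. *)
Lemma derivable_inverse f g (w : C) : derivable f w 1 -> cderiv f w != 0 ->
  g (f w) = w -> {for f w, continuous g} -> (\forall y \near f w, f (g y) = y) ->
  derivable g (f w) 1.
Proof.
move=> df k0 gw cg fg.
have [s [fs sw cs]] := proj1 (caratheodory f w (cderiv f w)) (conj df erefl).
suff [] : derivable g (f w) 1 /\ cderiv g (f w) = (cderiv f w)^-1 by [].
have csg : s (g y) @[y --> f w] --> s w.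
  have cs' : s z @[z --> g (f w)] --> s w by rewrite gw.
  exact: (@cvg_comp _ _ _ g s (nbhs (f w)) (nbhs (g (f w))) (nbhs (s w)) cg cs').
(* From y - f w = s (g y) (g y - w), where s (g y) is nonzero near f w because it tends to s w = f'
   (w). *)
apply/caratheodory; exists (fun y => (s (g y))^-1); split.
- have nz : \forall y \near f w, s (g y) != 0.
    by apply: (@cvgr_neq0 C C _ (nbhs (f w)) (nbhs_filter (f w)) _ _ csg); rewrite sw.
  have fsg : \forall y \near f w, f (g y) - f w = s (g y) * (g y - w).
    by apply: (cg [set z | f z - f w = s z * (z - w)]); rewrite gw; exact: fs.
  near=> y.
  have e1 : f (g y) = y by near: y.
  have e2 : f (g y) - f w = s (g y) * (g y - w) by near: y.
  have e3 : s (g y) != 0 by near: y.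
  have e4 : y - f w = s (g y) * (g y - w) by rewrite -e2 e1.
  by rewrite gw e4 mulKf.
- by rewrite gw sw.
- change ((s (g y))^-1 @[y --> f w] --> (s (g (f w)))^-1); rewrite gw.
  have nz : s w != 0 by rewrite sw.
  exact: (@cvgV C _ (nbhs (f w)) (nbhs_filter (f w)) _ _ nz csg).
Unshelve. all: by end_near. Qed.

Lemma cderiv_id (w : C) : cderiv id w = 1.
Proof.
suff [] : derivable (id : C -> C) w 1 /\ cderiv id w = 1 by [].
apply/cderivP => e e0; apply: (@nearW _ (nbhs w) _ (nbhs_filter w)) => z.
by rewrite mul1r subrr normr0 mulr_ge0// ltW.
Qed.

End ComplexDerivative.

(** * Transfer of integrals along the covering *)

Section Transfer.
Context {R : realType} (X Xt : @surface R) (pr : Xt -> X).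
Notation plane2 := (measurableTypeR R * measurableTypeR R)%type.
Let leb2 : {measure set plane2 -> \bar R} := (lebesgue_measure \x lebesgue_measure)%E.
Hypotheses (hX : riemann_surface X) (hXt : universal_cover pr).

(** The factor dz_c / dz_ct along [pr], called [k] in [flat_frame]. *)
Definition dpr (ct : @chart R Xt) (c : @chart R X) (x : Xt) : R[i] :=
  cderiv (coord c \o pr \o param ct) (coord ct x).

(** A piece of a sheet small enough to fit into one chart upstairs and over one chart downstairs.
    The notion passes to open subsets, so a countable basis provides countably many such pieces. *)
Definition evenly (N : set Xt) : Prop :=
  [/\ open N, set_inj N pr, forall B, open B -> B `<=` N -> open (pr @` B) &
    exists (c : @chart R X) (ct : @chart R Xt), [/\ atlas c, atlas ct, N `<=` dom ct & N `<=` pr @^-1` dom c]].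

Let hXtr : riemann_surface Xt. Proof. by case: hXt. Qed.

Lemma covering_continuous : continuous pr. Proof. by case: hXt => _ _ [h _] _. Qed.

Lemma evenlyW N B : evenly N -> open B -> B `<=` N -> evenly B.
Proof.
move=> [oN iN opN [c [ct [ac act Nt Nc]]]] oB BN; split => //.
- by move=> x y /[!inE] Bx By; apply: iN; rewrite inE; exact: BN.
- by move=> B' oB' /subset_trans B'B; apply: opN => //; exact: B'B.
- by exists c, ct; split => //; exact: subset_trans BN _.
Qed.

Lemma chart_atP (Y : @surface R) (p : Y) : riemann_surface Y ->
  atlas (chart_at p) /\ dom (chart_at p) p.
Proof. by case=> [[_ _ _ [_ h _ _]] _]; exact: h. Qed.

Lemma evenly_nbhs (x : Xt) : exists2 N, evenly N & N x.
Proof.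
have [_ _ [cpr cov] _] := hXt.
have [V [oV Vx [sh [_ shV shP]]]] := cov (pr x).
have : (pr @^-1` V) x by [].
rewrite shV => -[W sW Wx]; have [oW _ iW opW] := shP W sW.
have [ac cx] := chart_atP (pr x) hX; have [act ctx] := chart_atP x hXtr.
set c := chart_at (pr x) in ac cx; set ct := chart_at x in act ctx.
exists (W `&` (dom ct `&` pr @^-1` dom c)) => //; split.
- apply: openI => //; apply: openI; first exact: (open_dom hXtr).
  by apply: open_comp; [move=> *; exact: cpr|exact: (open_dom hX)].
- by move=> y z /[!inE] -[Wy _] [Wz _]; apply: iW; rewrite inE.
- by move=> B oB BW; apply: opW => //; apply: subset_trans BW _; exact: subIsetl.
- by exists c, ct; split => // y [_ []].
Qed.

Lemma evenly_cover : exists b : nat -> set Xt, (forall n, evenly (b n)) /\ forall x, exists n, b n x.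
Proof.
move: hXtr => [[_ [B cB [oB bB]] _ _] _].
have [e injB] := countable_injP _ cB.
pose P n := [set U | [/\ B U, evenly U & e U = n]].
exists (fun n => xget set0 (P n)); split.
(* An index not taken by a basic set gets the empty set, which is [evenly] as an open subset of any
   such piece. *)
- move=> n; case: xgetP => [U _ []//|_].
  have [N eN _] := evenly_nbhs point.
  by apply: evenlyW eN _ _; [exact: open0|exact: sub0set].
- move=> x; have [N eN Nx] := evenly_nbhs x.
  have oN : open N by case: eN.
  have [U [BU Ux] UN] := bB x N (open_nbhs_nbhs (conj oN Nx)).
  have eU : evenly U by apply: evenlyW eN _ UN; exact: oB.
  exists (e U); have PU : P (e U) U by [].
  have [BU' _ eUU] := xgetPex set0 (ex_intro _ U PU).
  by rewrite (injB _ _ _ _ eUU) // inE.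
Qed.

Section Sheet.
Variables (N : set Xt) (eN : evenly N).

Definition sec (q : X) : Xt := xget point [set x | N x /\ pr x = q].

Lemma secK x : N x -> sec (pr x) = x.
Proof.
move=> Nx; have [Ns e] := xgetPex point (ex_intro (fun y => N y /\ pr y = pr x) x (conj Nx erefl)).
by have [_ iN _ _] := eN; apply: iN; rewrite ?inE.
Qed.

Lemma open_sheet : open (pr @` N).
Proof. by have [oN _ h _] := eN; exact: h. Qed.

(** Read one way, openness of [pr] on [N] makes [sec] continuous; read the other way, measurability
    of [sec] makes images of Borel sets under [pr] Borel. *)
Lemma sec_preimage (B : set Xt) : (pr @` N) `&` sec @^-1` B = pr @` (N `&` B).
Proof.
rewrite eqEsubset; split => q.
  by move=> [[x Nx <-]]; rewrite /= secK// => Bx; exists x.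
by move=> [x [Nx Bx] <-]; split; [exists x|rewrite /= secK].
Qed.

Lemma sec_continuous : {within pr @` N, continuous sec}.
Proof.
apply/(within_continuousP _ open_sheet) => q [x Nx <-]; change (sec x0 @[x0 --> pr x] --> sec (pr x)); rewrite secK// => B.
rewrite nbhsE => -[B' [oB' B'x] B'B].
apply: (@filterS _ _ _ (pr @` (N `&` B'))).
  by rewrite -sec_preimage => y [_ h]; exact: B'B.
apply: open_nbhs_nbhs; split; last by exists x.
have [oN _ h _] := eN; apply: h; last exact: subIsetl.
exact: openI.
Qed.

Lemma measurable_sheet (S : set (borel Xt)) : measurable S -> S `<=` N ->
  measurable (pr @` S : set (borel X)).
Proof.
move=> mS SN; rewrite -(setIidr SN) -sec_preimage.
have := @within_continuous_borel X Xt _ sec open_sheet sec_continuous; apply => //.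
by apply: open_borel; exact: open_sheet.
Qed.

(** In this chart and [c] the projection is the identity of the plane, so no change of variables is
    left to perform. It is always a topological chart; membership in the atlas needs [dpr] to be
    nonzero. *)
Definition lift_chart (c : @chart R X) : @chart R Xt :=
  Chart N (coord c \o pr) (sec \o param c).

Lemma open_chart_image (Y : @surface R) (c : @chart R Y) (B : set Y) : riemann_surface Y ->
  atlas c -> open B -> B `<=` dom c -> open (coord c @` B).
Proof.
move=> hY ac oB Bc; have [_ oi pK _ cp] := atlas_valid hY ac.
rewrite (_ : coord c @` B = image_of c `&` param c @^-1` B).
  exact: open_within_preimage.
rewrite eqEsubset; split => w.
  move=> [p Bp <-]; split; first by exists p => //; exact: Bc.
  by rewrite /= pK//; exact: Bc.
by move=> [[p cp' <-]]; rewrite /= pK// => Bp; exists p.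
Qed.

Lemma lift_chart_valid c : atlas c -> N `<=` pr @^-1` dom c -> valid_chart (lift_chart c).
Proof.
move=> ac Nc; have [od oi pK cc cp] := atlas_valid hX ac.
have oN : open N by case: eN.
have sub : pr @` N `<=` dom c by move=> _ [x Nx <-]; exact: Nc.
have E : image_of (lift_chart c) = coord c @` (pr @` N).
  by rewrite /image_of /= image_comp.
have oI : open (image_of (lift_chart c)).
  by rewrite E; apply: open_chart_image => //; exact: open_sheet.
split => //=.
- by move=> p Np; rewrite pK ?secK//; exact: Nc.
- apply/(within_continuousP _ oN) => x Nx.
  apply: continuous_comp; first exact: covering_continuous.
  by move/(within_continuousP _ od) : cc; apply; exact: Nc.
- apply/(within_continuousP _ oI) => w; rewrite E => -[q qN <-].
  apply: continuous_comp.
    by move/(within_continuousP _ oi) : cp; apply; exists q => //; exact: sub.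
  rewrite pK; last exact: sub.
  by have := sec_continuous; move/(within_continuousP _ open_sheet); exact.
Qed.

Lemma dpr_derivable (ct : @chart R Xt) (c : @chart R X) (x : Xt) : atlas ct -> atlas c ->
  dom ct x -> dom c (pr x) -> derivable (coord c \o pr \o param ct) (coord ct x) 1.
Proof. by move=> act ac tx cx; have [_ _ _ h] := hXt; apply: (h ct c act ac); exists x. Qed.

(** By maximality of the atlas it suffices to check both transition maps against every chart
    [c']. *)
Lemma lift_chart_atlas c : atlas c -> N `<=` pr @^-1` dom c ->
  (forall x ct, N x -> atlas ct -> dom ct x -> dpr ct c x != 0) -> atlas (lift_chart c).
Proof.
move=> ac Nc nz; have [[_ _ _ [_ _ _ maxXt]] _] := hXtr.
have va := lift_chart_valid ac Nc; apply: maxXt => // c' ac'; split.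
- move=> _ [x [Nx c'x] <-].
  have := dpr_derivable ac' ac c'x (Nc _ Nx) => df.
  have := nz x c' Nx ac' c'x; rewrite /dpr => k0.
  (* [f] is the projection read in [c'] and [c], and the transition [g] is its local inverse:
     continuous since [sec] is, hence holomorphic where [f] has nonzero derivative. *)
  pose f := coord c \o pr \o param c'; pose g := coord c' \o param (lift_chart c).
  have Ew : f (coord c' x) = coord (lift_chart c) x by rewrite /f /= (paramK hXtr).
  have ax : param (lift_chart c) (coord (lift_chart c) x) = x by case: va => _ _ pK _ _; exact: pK.
  suff : derivable g (f (coord c' x)) 1 by rewrite Ew.
  apply: (@derivable_inverse R f g (coord c' x) df k0).
  + by rewrite Ew /g; congr (coord c' _).
  + rewrite Ew; apply: continuous_comp.
      have [_ oi _ _ cp] := va; move/(within_continuousP _ oi) : cp; apply.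
      by exists x.
    rewrite ax; have [od _ _ cc' _] := atlas_valid hXtr ac'.
    by move/(within_continuousP _ od) : cc'; apply.
  + rewrite Ew; have [oN _ pK _ _] := va.
    have oNc : open (N `&` dom c') by apply: openI => //; exact: (open_dom hXtr).
    have oI : open (coord c @` (pr @` (N `&` dom c'))).
      apply: (open_chart_image hX ac).
        by have [_ _ h _] := eN; apply: h => //; exact: subIsetl.
      by move=> _ [y [Ny _] <-]; exact: Nc.
    apply: (near_of_open oI); first by exists (pr x) => //; exists x.
    move=> _ [_ [y [Ny c'y] <-] <-].
    have e1 : sec (param c (coord c (pr y))) = y by rewrite (paramK hX) ?secK//; exact: Nc.
    by rewrite /f /g /= e1 (paramK hXtr).
(* The opposite transition is the projection itself read in [c'] and [c]. *)
- move=> _ [x [c'x Nx] <-]; exact: dpr_derivable (Nc _ Nx).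
Qed.

Lemma dpr_lift c x : atlas c -> N `<=` pr @^-1` dom c -> N x -> dpr (lift_chart c) c x = 1.
Proof.
move=> ac Nc Nx; rewrite /dpr.
have oI : open (image_of (lift_chart c)) by have [] := lift_chart_valid ac Nc.
rewrite (@near_cderiv _ _ id) ?cderiv_id//.
apply: (near_of_open oI); first by exists x.
by move=> _ [y Ny <-]; rewrite /= (paramK hX) ?secK//; exact: Nc.
Qed.

Lemma image_critical_null (c : @chart R X) (ct : @chart R Xt) (Z : set Xt) :
  atlas c -> atlas ct -> Z `<=` dom ct -> Z `<=` pr @^-1` dom c ->
  (forall x, Z x -> dpr ct c x = 0) -> leb2.-negligible (chart_set c (pr @` Z)).
Proof.
move=> ac act Zt Zc Z0.
pose f (v : R * R) : R * R := plane (coord c (pr (param ct (cplx v)))).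
rewrite (_ : chart_set c _ = f @` (chart_set ct Z)); last first.
  rewrite eqEsubset; split => v.
    move=> [_ [x Zx <-] e]; exists (plane (coord ct x)).
      by rewrite /chart_set/= planeK; exists x.
    by rewrite /f planeK (paramK hXtr)//; [rewrite e cplxK|exact: Zt].
  move=> [w [x Zx e] <-]; rewrite /chart_set /f /= planeK -e (paramK hXtr)//; last exact: Zt.
  by exists (pr x) => //; exists x.
refine (@flat_image_null R f (chart_set ct Z) _) => z [x Zx e] r r0.
have := dpr_derivable act ac (Zt _ Zx) (Zc _ Zx) => df.
(* The halving absorbs the constant in |cplx v| <= 2 |v|, since R * R carries the sup norm. *)
have /cderivP/(_ (r / 2)%:C) H := conj df (Z0 _ Zx).
have /H : 0 < (r / 2)%:C :> R[i] by rewrite ltcR divr_gt0.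
rewrite e => /continuous_cplx/nbhs_ballP[d /= d0 hd].
(* Half the radius, because [flat_image_null] uses a closed condition on |w - z| and the ball is
   open. *)
exists (d / 2); first by rewrite divr_gt0.
move=> w _ wz; have /hd /= : ball z d w.
  rewrite -ball_normE /= distrC; apply: le_lt_trans wz _.
  by rewrite ltr_pdivrMr// ltr_pMr// ltr1n.
rewrite mul0r subr0 => h.
rewrite /f (_ : _ - _ = plane ((coord c (pr (param ct (cplx w)))) - (coord c (pr (param ct (cplx z)))))); last first.
  by rewrite /plane; case: (coord _ _) => a b; case: (coord _ _).
apply: norm_plane_le; apply: le_trans h _.
have nb : `|cplx w - cplx z| <= (2 * `|w - z|)%:C.
  apply: le_trans (normc_le_ReIm _) _; rewrite lecR /= mulr_natl mulr2n.
  by rewrite prod_normE lerD// le_max lexx ?orbT.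
apply: (@le_trans _ _ ((r / 2)%:C * (2 * `|w - z|)%:C)).
  by rewrite ler_wpM2l// lecR ltW// divr_gt0.
by rewrite -rmorphM/= lecR mulrA divfK.
Qed.

End Sheet.

Variables (u : X -> R) (g : Xt -> R).
Hypotheses (cu : continuous u) (cg : continuous g) (u0 : forall q, 0 <= u q).
(** The 2-form g dA on [Xt] is the pullback of u dA on [X]: |dpr|^2 is the real Jacobian of the
    projection. *)
Hypothesis gu : forall ct c x, atlas ct -> atlas c -> dom ct x -> dom c (pr x) ->
  (g x * metric ct x)%:C = (u (pr x) * metric c (pr x))%:C * `|dpr ct c x| ^+ 2.

Let mu_ (S : set (borel X)) : measurable_fun S (fun q => (u q)%:E).
Proof.
apply/measurable_EFinP; apply: measurable_funTS.
by apply: (@within_continuous_borelR R X setT u openT); exact: continuous_subspaceT.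
Qed.

Let mg_ (S : set (borel Xt)) : measurable_fun S (fun x => (g x)%:E).
Proof.
apply/measurable_EFinP; apply: measurable_funTS.
by apply: (@within_continuous_borelR R Xt setT g openT); exact: continuous_subspaceT.
Qed.

(** Positivity of [g] excludes zeros of [dpr] by [gu], so [lift_chart] belongs to the atlas.
    Computed in it and in [c], both sides are integrals over the same planar set, and [gu] with
    [dpr] = 1 identifies the integrands. *)
Lemma integral_regular (N : set Xt) (S : set (borel Xt)) : evenly N -> measurable S -> S `<=` N ->
  (forall x, N x -> 0 < g x) ->
  (\int[area Xt]_(x in S) (g x)%:E = \int[area X]_(q in pr @` S) (u q)%:E)%E.
Proof.
move=> eN mS SN gpos; have [oN iN opN [c [ct [ac act Nt Nc]]]] := eN.
have aL : atlas (lift_chart N c).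
  apply: lift_chart_atlas => // x ct' Nx act' ctx'.
  apply/eqP => k0; have := gu act' ac ctx' (Nc _ Nx).
  rewrite k0 normr0 expr0n/= mulr0 => -[] /eqP; rewrite mulf_eq0 gt_eqF ?gpos//=.
  by rewrite gt_eqF// (metric_gt0 hXtr).
have pSc : pr @` S `<=` dom c by move=> _ [x Sx <-]; exact/Nc/SN.
have mpS := measurable_sheet eN mS SN.
rewrite (integral_chart hXtr aL mS SN); last 2 first.
- by move=> x /SN/gpos; rewrite lee_fin => /ltW.
- exact: mg_.
rewrite (integral_chart hX ac mpS pSc); last 2 first.
- by move=> q _; rewrite lee_fin.
- exact: mu_.
have E : chart_set (lift_chart N c) S = chart_set c (pr @` S).
  by have H := image_comp pr (coord c) S; rewrite /chart_set H.
rewrite E; apply: eq_integral => v; rewrite inE => -[_ [x Sx <-] e].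
have Nx := SN _ Sx.
rewrite -e /= (paramK hX) ?secK//; last exact: Nc.
rewrite -!EFinM; congr (_%:E).
have := gu aL ac Nx (Nc _ Nx); rewrite dpr_lift// normr1 expr1n mulr1.
by case.
Qed.

Hypothesis g0 : forall x, 0 <= g x.

(** Where g = 0, [gu] leaves two cases: u > 0 at the image, so [dpr] vanishes and the image of these
    points is null, or u = 0 there. *)
Lemma integral_critical (N : set Xt) (S : set (borel Xt)) : evenly N -> measurable S -> S `<=` N ->
  (forall x, S x -> g x = 0) -> (\int[area X]_(q in pr @` S) (u q)%:E = 0)%E.
Proof.
move=> eN mS SN gz; have [oN iN opN [c [ct [ac act Nt Nc]]]] := eN.
pose U := pr @^-1` (u @^-1` [set r | 0 < r]).
have mU : measurable (U : set (borel Xt)).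
  apply: open_borel; apply: open_comp => [? _|]; first exact: covering_continuous.
  by apply: open_comp => [? _|]; [exact: cu|exact: open_gt].
pose Z := S `&` U.
have mZ : measurable (Z : set (borel Xt)) by exact: measurableI.
have ZN : Z `<=` N by move=> x [/SN].
have mpZ := measurable_sheet eN mZ ZN.
have Zc : pr @` Z `<=` dom c by move=> _ [x /ZN/Nc ? <-].
have nullZ : area X (pr @` Z) = 0%E.
  rewrite (area_chart hX ac mpZ Zc).
  apply: null_set_integral.
  - exact: (measurable_chart_set hX ac mpZ Zc).
  - apply/measurable_EFinP; apply: (measurable_funS (measurable_image2 hX ac)).
      exact: (chart_set_sub hX ac Zc).
    exact: (measurable_metric hX ac).
  - apply: measure_negligible; first exact: (measurable_chart_set hX ac mpZ Zc).
    apply: (image_critical_null ac act) => [x /ZN/Nt//|x /ZN/Nc//|x Zx].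
    have [Sx ux] := Zx; have := gu act ac (Nt _ (SN _ Sx)) (Nc _ (SN _ Sx)).
    rewrite gz// mul0r => /esym/eqP; rewrite mulf_eq0 expf_eq0/= normr_eq0 => /orP[/eqP[] /eqP|/eqP//].
    rewrite mulf_eq0 gt_eqF//= gt_eqF//.
    exact: (metric_gt0 hX ac (Nc _ (SN _ Sx))).
pose Y := S `\` U.
have mY : measurable (Y : set (borel Xt)) by exact: measurableD.
have YN : Y `<=` N by move=> x [/SN].
have mpY := measurable_sheet eN mY YN.
have -> : pr @` S = pr @` Z `|` pr @` Y by rewrite -image_setU /Z /Y setUIDK.
rewrite ge0_integral_setU//.
- rewrite (null_set_integral mpZ (@mu_ _) nullZ) add0e.
  apply: integral0_eq => _ [x [_ /negP ux] <-].
  by apply/eqP; rewrite eqe eq_le u0 andbT leNgt ux.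
- by move=> q _; rewrite lee_fin.
- apply/disj_setPS => q [[x [Sx Ux] <-] [y [_ Uy] e]].
  by apply: Uy; rewrite /U /preimage/= e.
Qed.

(** Splits [S] by the sign of [g]. Continuity of [g] makes {g > 0} open, so that it cuts out of [N]
    another [evenly] piece. *)
Lemma integral_sheet (N : set Xt) (S : set (borel Xt)) : evenly N -> measurable S -> S `<=` N ->
  (\int[area Xt]_(x in S) (g x)%:E = \int[area X]_(q in pr @` S) (u q)%:E)%E.
Proof.
move=> eN mS SN; pose P := g @^-1` [set r | 0 < r].
have oP : open P by apply: open_comp => [? _|]; [exact: cg|exact: open_gt].
have mP : measurable (P : set (borel Xt)) by exact: open_borel.
have eNP : evenly (N `&` P).
  have oN : open N by case: eN.
  by apply: (evenlyW eN); [exact: openI|exact: subIsetl].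
have mSP : measurable (S `&` P : set (borel Xt)) by exact: measurableI.
have mSD : measurable (S `\` P : set (borel Xt)) by exact: measurableD.
have gz x : (S `\` P) x -> g x = 0.
  by move=> [_ /negP h]; apply/eqP; rewrite eq_le g0 andbT leNgt h.
rewrite -[in LHS](setUIDK S P) -[in RHS](setUIDK S P) image_setU.
have SPN : S `&` P `<=` N by move=> x [/SN].
have SDN : S `\` P `<=` N by move=> x [/SN].
rewrite (ge0_integral_setU _ mSP mSD (@mg_ _)); last 2 first.
- by move=> x _; rewrite lee_fin.
- by apply/disj_setPS => x [[_ +] [_]].
rewrite (ge0_integral_setU _ (measurable_sheet eN mSP SPN) (measurable_sheet eN mSD SDN) (@mu_ _)); last 2 first.
- by move=> x _; rewrite lee_fin.
- apply/disj_setPS => _ [[x [Sx Px] <-] [y [Sy Py] e]]; apply: Py.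
  have [_ iN _ _] := eN; have -> // : y = x.
  by apply: iN; rewrite ?inE//; exact: SN.
rewrite (integral_critical eN mSD SDN gz) (@integral0_eq _ _ _ _ (S `\` P : set (borel Xt))); last first.
  by move=> x /gz ->.
congr (_ + _)%E; apply: (integral_regular eNP mSP).
  by move=> x [/SN].
by move=> x [].
Qed.

(** D is cut into disjoint Borel pieces, each within one sheet. Existence of representatives makes
    their images cover [X], uniqueness makes the images disjoint, and both integrals are summed over
    the pieces. *)
Theorem integral_transfer (D : set (borel Xt)) : fundamental_domain pr D ->
  (\int[area Xt]_(x in D) (g x)%:E = \int[area X]_q (u q)%:E)%E.
Proof.
move=> [mD hD]; have [b [eb cb]] := evenly_cover.
pose F := seqDU (fun n => D `&` b n) : nat -> set (borel Xt).
have mF n : measurable (F n).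
  apply: seqDU_measurable => k; apply: measurableI => //; apply: open_borel.
  by case: (eb k).
have FS n : F n `<=` D `&` b n by exact: subset_seqDU.
have FD n : F n `<=` D by apply: subset_trans (FS n) _; exact: subIsetl.
have Fb n : F n `<=` b n by apply: subset_trans (FS n) _; exact: subIsetr.
have tF := trivIset_seqDU (fun n => D `&` b n).
have UF : D = \bigcup_n F n.
  rewrite -seqDU_bigcup_eq -setI_bigcupr eqEsubset; split => x; last by case.
  by move=> Dx; split => //; have [n bx] := cb x; exists n.
have UpF : setT = \bigcup_n (pr @` F n).
  rewrite -image_bigcup -UF eqEsubset; split => // q _.
  by have [x [[Dx <-] _]] := hD q; exists x.
have mpF n : measurable (pr @` F n : set (borel X)).
  exact (measurable_sheet (eb n) (mF n) (Fb n)).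
have tpF : trivIset setT (fun n => pr @` F n).
  move=> m n _ _ [q [[x Fx <-] [y Fy e]]].
  have xy : x = y.
    have [z [_ h]] := hD (pr x).
    by rewrite -(h x) ?(h y)//; split => //; [exact: (FD n)|exact: (FD m)].
  by apply: (tF m n) => //; exists x; split => //; rewrite xy.
rewrite [in LHS]UF [in RHS]UpF.
rewrite (ge0_integral_bigcup (area Xt) mF (@mg_ _) _ tF); last by move=> x _; rewrite lee_fin.
rewrite (ge0_integral_bigcup (area X) mpF (@mu_ _) _ tpF); last by move=> x _; rewrite lee_fin.
by apply: eq_eseriesr => n _; exact: (integral_sheet (eb n)).
Qed.

End Transfer.

(** * Smooth functions *)

Section SmoothAlgebra.
Context {R : realType} {V : normedModType R}.
Implicit Types (U : set V) (f g : V -> R).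

Lemma eq_within_continuous U f g : open U -> (forall x, U x -> f x = g x) ->
  {within U, continuous f} -> {within U, continuous g}.
Proof.
move=> oU fg /(within_continuousP _ oU) cf; apply/(within_continuousP _ oU) => x Ux.
change (g y @[y --> x] --> g x); rewrite -fg//; apply: cvg_trans (cf x Ux).
by apply: near_eq_cvg; apply: (near_of_open oU Ux).
Qed.

Lemma eq_Ck k U f g : open U -> (forall x, U x -> f x = g x) -> Ck k U f -> Ck k U g.
Proof.
move=> oU; elim: k f g => [|k IH] f g fg.
  by move=> [cf _]; split => //; exact: eq_within_continuous fg cf.
move=> [cf df]; split; first exact: eq_within_continuous fg cf.
move=> v; have [dfv Cf] := df v; split.
  move=> x Ux; apply: near_eq_derivable (dfv x Ux); apply: (near_of_open oU Ux) => y; exact: fg.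
apply: IH Cf => x Ux; apply: near_eq_derive; apply: (near_of_open oU Ux) => y; exact: fg.
Qed.

Lemma CkW k U f : Ck k.+1 U f -> Ck k U f.
Proof.
elim: k f => [|k IH] f [cf df]; first by [].
by split => // v; have [dfv Cf] := df v; split => //; exact: IH.
Qed.

Lemma Ck_cst k U (a : R) : Ck k U (cst a).
Proof.
elim: k a => [|k IH] a; first by split => //; apply: continuous_subspaceT => x; exact: cvg_cst.
split; first by apply: continuous_subspaceT => x; exact: cvg_cst.
move=> v; split; first by move=> x _; exact: derivable_cst.
rewrite (_ : 'D_v _ = cst 0); first exact: IH.
by apply/funext => x; exact: derive_cst.
Qed.

Lemma Ck_add k U f g : open U -> Ck k U f -> Ck k U g -> Ck k U (fun x => f x + g x).
Proof.
move=> oU; elim: k f g => [|k IH] f g [cf df] [cg dg].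
  by split => //; exact: (@within_continuousD _ R R).
split; first exact: (@within_continuousD _ R R).
move=> v; have [dfv Cf] := df v; have [dgv Cg] := dg v; split.
  by move=> x Ux; apply: derivableD; [exact: dfv|exact: dgv].
apply: eq_Ck (IH _ _ Cf Cg) => // x Ux.
by rewrite -deriveD//; [exact: dfv|exact: dgv].
Qed.

Lemma Ck_mul k U f g : open U -> Ck k U f -> Ck k U g -> Ck k U (fun x => f x * g x).
Proof.
move=> oU.
have cm f1 g1 : {within U, continuous f1} -> {within U, continuous g1} ->
    {within U, continuous (fun x => f1 x * g1 x)}.
  move=> /(within_continuousP _ oU) cf /(within_continuousP _ oU) cg.
  apply/(within_continuousP _ oU) => x Ux.
  by apply: cvgM; [exact: cf|exact: cg].
elim: k f g => [|k IH] f g Cf Cg; first by split => //; case: Cf; case: Cg => *; exact: cm.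
(* In Leibniz' rule a derivative of class k multiplies an undifferentiated factor of class k + 1,
   which must first be lowered to class k. *)
have C'f := CkW Cf; have C'g := CkW Cg.
move: Cf Cg => [cf df] [cg dg]; split; first exact: cm.
move=> v; have [dfv Cf] := df v; have [dgv Cg] := dg v; split.
  by move=> x Ux; apply: derivableM; [exact: dfv|exact: dgv].
apply: eq_Ck (Ck_add oU (IH _ _ C'f Cg) (IH _ _ C'g Cf)) => // x Ux.
by rewrite -[LHS](@deriveM _ _ f g)//; [exact: dfv|exact: dgv].
Qed.

Lemma Ck_opp k U f : open U -> Ck k U f -> Ck k U (fun x => - f x).
Proof.
move=> oU Cf; apply: eq_Ck (Ck_mul oU (Ck_cst k U (-1)) Cf) => // x _ /=.
by rewrite mulN1r.
Qed.

Lemma Ck_inv k U f : open U -> (forall x, U x -> f x != 0) -> Ck k U f -> Ck k U (fun x => (f x)^-1).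
Proof.
move=> oU f0.
have ci : {within U, continuous f} -> {within U, continuous (fun x => (f x)^-1)}.
  move=> /(within_continuousP _ oU) cf.
  apply/(within_continuousP _ oU) => x Ux.
  by apply: cvgV; [exact: f0|exact: cf].
elim: k => [|k IH] Cf; first by split => //; apply: ci; case: Cf.
have Ci := IH (CkW Cf).
have [cf df] := Cf; split; first exact: ci.
move=> v; have [dfv Cfv] := df v; split.
  by move=> x Ux; apply: derivableV; [exact: f0|exact: dfv].
apply: eq_Ck (Ck_opp oU (Ck_mul oU (Ck_mul oU Ci Ci) Cfv)) => // x Ux.
rewrite -[RHS]/('D_v (fun y => (f y)^-1) x) (@deriveV _ _ f x v (f0 _ Ux) (dfv _ Ux)).
by rewrite -exprVn expr2 scaleNr.
Qed.

Lemma eq_smooth U f g : open U -> (forall x, U x -> f x = g x) -> smooth U f -> smooth U g.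
Proof. by move=> oU fg sf k; apply: eq_Ck (sf k). Qed.

Lemma smooth_derivable U f x v : smooth U f -> U x -> derivable f x v.
Proof. by move=> sf Ux; have [_ h] := sf 1%N; apply: (h v).1. Qed.

Lemma smooth_derive U f v : smooth U f -> smooth U ('D_v f).
Proof. by move=> sf k; have [_ h] := sf k.+1; exact: (h v).2. Qed.

Lemma smooth_continuous U f : smooth U f -> {within U, continuous f}.
Proof. by move=> sf; have [] := sf 0%N. Qed.

Implicit Types F G : V -> R[i].

Lemma eq_smoothC U F G : open U -> (forall x, U x -> F x = G x) -> smoothC U F -> smoothC U G.
Proof. by move=> oU fg [sr si]; split; [apply: eq_smooth sr|apply: eq_smooth si] => // x Ux; rewrite fg. Qed.

Lemma smoothC_cst U (a : R[i]) : smoothC U (fun _ => a).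
Proof. by split=> k; exact: Ck_cst. Qed.

Lemma smoothC_add U F G : open U -> smoothC U F -> smoothC U G -> smoothC U (fun x => F x + G x).
Proof.
move=> oU [a b] [c d]; split.
  apply: (eq_smooth oU _ (fun k => Ck_add oU (a k) (c k))) => x _ /=; by case: (F x) (G x) => ? ? [].
apply: (eq_smooth oU _ (fun k => Ck_add oU (b k) (d k))) => x _ /=; by case: (F x) (G x) => ? ? [].
Qed.

Lemma smoothC_mul U F G : open U -> smoothC U F -> smoothC U G -> smoothC U (fun x => F x * G x).
Proof.
move=> oU [a b] [c d]; split.
  apply: (eq_smooth oU _ (fun k => Ck_add oU (Ck_mul oU (a k) (c k)) (Ck_opp oU (Ck_mul oU (b k) (d k))))) => x _ /=.
  by case: (F x) (G x) => ? ? [].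
apply: (eq_smooth oU _ (fun k => Ck_add oU (Ck_mul oU (a k) (d k)) (Ck_mul oU (b k) (c k)))) => x _ /=.
by case: (F x) (G x) => ? ? [].
Qed.

Lemma smoothC_sum U (I : Type) (r : seq I) (P : pred I) (F : I -> V -> R[i]) : open U ->
  (forall i, P i -> smoothC U (F i)) -> smoothC U (fun x => \sum_(i <- r | P i) F i x).
Proof.
move=> oU h; elim: r => [|i r IH].
  by apply: (eq_smoothC oU _ (smoothC_cst U 0)) => x _; rewrite big_nil.
case Pi : (P i); last by apply: (eq_smoothC oU _ IH) => x _; rewrite big_cons Pi.
by apply: (eq_smoothC oU _ (smoothC_add oU (h i Pi) IH)) => x _; rewrite big_cons Pi.
Qed.

Lemma smoothC_conj U F : open U -> smoothC U F -> smoothC U (fun x => conjc (F x)).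
Proof.
move=> oU [a b]; split.
  by apply: (eq_smooth oU _ a) => x _; case: (F x).
by apply: (eq_smooth oU _ (fun k => Ck_opp oU (b k))) => x _; case: (F x).
Qed.

Lemma smoothC_inv U F : open U -> (forall x, U x -> F x != 0) -> smoothC U F ->
  smoothC U (fun x => (F x)^-1).
Proof.
move=> oU F0 sF; have [a b] := sF.
pose n x := complex.Re (F x) * complex.Re (F x) + complex.Im (F x) * complex.Im (F x).
have n0 x : U x -> n x != 0.
  move=> Ux; have := F0 _ Ux; rewrite /n -!expr2; apply: contraNneq => /eqP.
  rewrite paddr_eq0 ?sqr_ge0// !sqrf_eq0 => /andP[/eqP h1 /eqP h2].
  by case: (F x) h1 h2 => ? ? /= -> ->.
have sn : smooth U n by move=> k; exact: (Ck_add oU (Ck_mul oU (a k) (a k)) (Ck_mul oU (b k) (b k))).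
have si : smoothC U (fun x => (n x)^-1%:C).
  by split => k; [exact: Ck_inv|exact: Ck_cst].
apply: (eq_smoothC oU _ (smoothC_mul oU si (smoothC_conj oU sF))) => x Ux.
apply: (mulIf (F0 _ Ux)); rewrite mulVf ?F0//.
have := n0 _ Ux; rewrite /n; case: (F x) => p q /= h.
apply/eqP; rewrite eq_complex /=; apply/andP; split; apply/eqP; field; exact: h.
Qed.

End SmoothAlgebra.

(** * The canonical lift near 0 *)

Section Matrix2.
Context {F : fieldType}.
Implicit Types A : 'M[F]_2.

Lemma big_ord2 (V : nmodType) (f : 'I_2 -> V) : \sum_i f i = f 0 + f 1.
Proof. by rewrite !big_ord_recl big_ord0 addr0; congr (_ + f _); apply: val_inj. Qed.

Lemma ord2P (P : 'I_2 -> Prop) : P 0 -> P 1 -> forall i, P i.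
Proof.
move=> P0 P1 [[|[|//]] h]; first by rewrite (_ : Ordinal h = 0)//; apply: val_inj.
by rewrite (_ : Ordinal h = 1)//; apply: val_inj.
Qed.

(** The adjugate; subtraction in 'I_2 is modulo 2, so 1 - i is the other index. *)
Definition adj2 A : 'M[F]_2 := \matrix_(i, j) if i == j then A (1 - i) (1 - i) else - A i j.

Lemma det2 A : \det A = A 0 0 * A 1 1 - A 0 1 * A 1 0.
Proof.
rewrite (expand_det_row _ 0) big_ord2 /cofactor !det_mx11 !mxE /=.
rewrite (_ : lift 0 0 = 1 :> 'I_2); last exact: val_inj.
rewrite (_ : lift 1 0 = 0 :> 'I_2); last exact: val_inj.
by rewrite expr0 mul1r expr1 mulN1r mulrN.
Qed.

(** Displays the entries of the inverse as rational functions of those of [A], whence smoothness of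
    pointwise inverses. *)
Lemma invmx2 A : A \in unitmx -> invmx A = (\det A)^-1 *: adj2 A.
Proof.
move=> uA; apply: (can_inj (mulKmx uA)).
rewrite mulmxV// -scalemxAr.
have d := det2 A.
have d0 : \det A != 0 by rewrite -unitfE -unitmxE.
have e01 : (1 - 1 : 'I_2) = 0 by exact: subrr.
have e00 : (1 - 0 : 'I_2) = 1 by exact: subr0.
apply/matrixP; apply: ord2P; apply: ord2P; rewrite !mxE big_ord2 !mxE /= ?e01 ?e00 ?d;
  rewrite ?d in d0 *; by [ring|field].
Qed.
End Matrix2.

Section ChartSmooth.
Context {R : realType}.
Notation M2 := 'M[R[i]]_2.
Variables (X : @surface R) (hX : riemann_surface X) (c : @chart R X) (ac : atlas c).
Implicit Types u w : X -> M2.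
Let oI : open (image2_of c). Proof. exact: (open_image2 hX ac). Qed.

Lemma smooth_chart_add u w : smooth_chart c u -> smooth_chart c w ->
  smooth_chart c (fun p => u p + w p).
Proof.
move=> su sw i j; apply: (eq_smoothC oI _ (smoothC_add oI (su i j) (sw i j))) => v _.
by rewrite /local_entry mxE.
Qed.

Lemma smooth_chart_scale (a : X -> R[i]) u :
  smoothC (image2_of c) (fun v => a (param c (cplx v))) -> smooth_chart c u ->
  smooth_chart c (fun p => a p *: u p).
Proof.
move=> sa su i j; apply: (eq_smoothC oI _ (smoothC_mul oI sa (su i j))) => v _.
by rewrite /local_entry mxE.
Qed.

Lemma smooth_chart_scalec (a : R[i]) u : smooth_chart c u -> smooth_chart c (fun p => a *: u p).
Proof. by apply: (smooth_chart_scale (a := fun=> a)); exact: smoothC_cst. Qed.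

Lemma smooth_chart_sub u w : smooth_chart c u -> smooth_chart c w ->
  smooth_chart c (fun p => u p - w p).
Proof.
move=> su sw; have h := smooth_chart_add su (smooth_chart_scalec (-1) sw).
by move=> i j; apply: (eq_smoothC oI _ (h i j)) => v _; rewrite /local_entry scaleN1r.
Qed.

Lemma smooth_chart_mul u w : smooth_chart c u -> smooth_chart c w ->
  smooth_chart c (fun p => u p *m w p).
Proof.
move=> su sw i j.
apply: (eq_smoothC oI _ (smoothC_sum (index_enum _) (P := xpredT) oI (fun k _ => smoothC_mul oI (su i k) (sw k j)))) => v _.
by rewrite /local_entry mxE.
Qed.

Lemma smooth_chart_adj u : smooth_chart c u -> smooth_chart c (fun p => adj (u p)).
Proof.
move=> su i j; apply: (eq_smoothC oI _ (smoothC_conj oI (su j i))) => v _.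
by rewrite /local_entry !mxE.
Qed.

Lemma smooth_chart_inv u : (forall p, u p \in unitmx) -> smooth_chart c u ->
  smooth_chart c (fun p => invmx (u p)).
Proof.
move=> uu su.
have sd : smoothC (image2_of c) (fun v => \det (u (param c (cplx v)))).
  apply: (eq_smoothC oI _ (smoothC_add oI (smoothC_mul oI (su 0 0) (su 1 1))
    (smoothC_mul oI (smoothC_cst _ (-1)) (smoothC_mul oI (su 0 1) (su 1 0))))) => v _.
  by rewrite det2 mulN1r.
have si : smoothC (image2_of c) (fun v => (\det (u (param c (cplx v))))^-1).
  by apply: smoothC_inv => // v _; rewrite -unitfE -unitmxE.
have sa : smooth_chart c (fun p => adj2 (u p)).
  move=> i j; have [ij|ij] := eqVneq i j.
    by apply: (eq_smoothC oI _ (su (1 - i) (1 - j))) => v _; rewrite /local_entry mxE ij eqxx.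
  apply: (eq_smoothC oI _ (smoothC_mul oI (smoothC_cst _ (-1)) (su i j))) => v _.
  by rewrite /local_entry mxE (negbTE ij) mulN1r.
have h := smooth_chart_scale (a := fun p => (\det (u p))^-1) si sa.
by move=> i j; apply: (eq_smoothC oI _ (h i j)) => v _; rewrite /local_entry invmx2.
Qed.

Lemma smooth_chart_pd e u : smooth_chart c u -> smooth_chart c (pd e c u).
Proof.
move=> su i j; have [sr si] := su i j.
split; [apply: (eq_smooth oI _ (smooth_derive e sr))|apply: (eq_smooth oI _ (smooth_derive e si))] => v iv;
  by rewrite /local_entry mxE /= (image2P hX ac iv).2.
Qed.

Lemma smooth_chart_dz u : smooth_chart c u -> smooth_chart c (dz c u).
Proof.
move=> su; apply/smooth_chart_scalec/smooth_chart_sub; first exact: smooth_chart_pd.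
exact/smooth_chart_scalec/smooth_chart_pd.
Qed.

End ChartSmooth.

Section Product.
Context {R : realType}.
Notation R2 := (R * R)%type.

(** [is_lift] demands smoothness jointly in the parameter and the chart coordinates. The canonical
    lift is a polynomial in functions of one of the two factors, so each kind is treated alone. *)
Lemma Ck_snd k (U : set R2) (f : R2 -> R) : open U -> Ck k U f ->
  Ck k ((@snd R2 R2) @^-1` U) (f \o snd).
Proof.
move=> oU; have oW : open ((@snd R2 R2) @^-1` U).
  by apply: open_comp => // x _; exact: cvg_snd.
have cc g : {within U, continuous g} -> {within (@snd R2 R2) @^-1` U, continuous (g \o snd : _ -> R)}.
  move=> /(within_continuousP _ oU) cg; apply/(within_continuousP _ oW) => x Ux.
  by apply: continuous_comp; [exact: cvg_snd|exact: cg].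
elim: k f => [|k IH] f [cf df]; first by split => //; exact: cc.
split; first exact: cc.
move=> v; have [dfv Cf] := df v.2; split; first by move=> x Ux; exact: (dfv x.2 Ux).
have -> : 'D_v (f \o snd) = 'D_(v.2) f \o snd by apply/funext.
exact: IH.
Qed.

Lemma Ck_linear (V : normedModType R) k (U : set V) (l : {linear V -> R}) : continuous l -> Ck k U l.
Proof.
move=> cl; case: k => [|k]; first by split => //; exact: continuous_subspaceT.
have D (v x : V) : h^-1 *: ((l \o shift x) (h *: v) - l x) @[h --> 0^'] --> l v.
  apply: cvg_near_cst; rewrite near_withinE; apply: nearW => h h0 /=.
  have -> : l (h *: v + x) - l x = h * l v by rewrite linearD linearZ/= addrK.
  by rewrite [_ *: _]mulrA mulVf// mul1r.
split; first exact: continuous_subspaceT.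
move=> v; split; first by move=> x _; apply/cvg_ex; exists (l v); exact: D.
rewrite (_ : 'D_v l = cst (l v)); first exact: Ck_cst.
by apply/funext => x; apply: cvg_lim => //; exact: D.
Qed.

Lemma smoothC_cplx_fst (U : set (R2 * R2)) : smoothC U (fun u => cplx u.1).
Proof.
pose l1 (u : R2 * R2) := u.1.1; pose l2 (u : R2 * R2) := u.1.2.
have l1l : linear l1 by move=> a x y.
have l2l : linear l2 by move=> a x y.
pose L1 := HB.pack_for {linear (R2 * R2)%type -> R} l1 (GRing.isLinear.Build _ _ _ _ l1 l1l).
pose L2 := HB.pack_for {linear (R2 * R2)%type -> R} l2 (GRing.isLinear.Build _ _ _ _ l2 l2l).
split=> k; [apply: (@Ck_linear _ k U L1)|apply: (@Ck_linear _ k U L2)] => x.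
  by apply: (@continuous_comp _ _ _ fst fst); exact: cvg_fst.
by apply: (@continuous_comp _ _ _ fst snd); [exact: cvg_fst|exact: cvg_snd].
Qed.

End Product.

Section Lift.
Context {R : realType}.
Variables (X : @surface R) (hX : riemann_surface X) (H : X -> 'M[R[i]]_2).
Hypothesis hH : hermitian_metric H.

Lemma posdef_unit (M : 'M[R[i]]_2) : posdef M -> M \in unitmx.
Proof.
move=> [aM pM]; rewrite -unitmx_tr -row_free_unit -kermx_eq0; apply/rowV0P => v /sub_kermxP vM.
apply/eqP/negPn/negP => v0.
have vt : v^T != 0 by rewrite trmx_eq0.
have := pM _ vt; rewrite -mulmxA (_ : M *m v^T = 0) ?mulmx0 ?mxE ?ltxx//.
by rewrite -[M]trmxK -trmx_mul vM trmx0.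
Qed.

Lemma smooth_hadj (Phi : oneform X) c : form10 Phi -> atlas c -> smooth_chart c (hadj H Phi c).
Proof.
move=> [sP _] ac; have [sH pH] := hH.
apply: (smooth_chart_mul hX ac); last exact: sH.
apply: (smooth_chart_mul hX ac); last exact/(smooth_chart_adj hX ac)/sP.
by apply: (smooth_chart_inv hX ac) => [p|]; [exact: posdef_unit|exact: sH].
Qed.

Lemma smooth_chern (A : oneform X) c : form01 A -> atlas c -> smooth_chart c (chern H A c).
Proof.
move=> [sA _] ac; have [sH pH] := hH.
apply: (smooth_chart_mul hX ac).
  by apply: (smooth_chart_inv hX ac) => [p|]; [exact: posdef_unit|exact: sH].
apply: (smooth_chart_sub hX ac); first exact/(smooth_chart_dz hX ac)/sH.
by apply: (smooth_chart_mul hX ac); [exact/(smooth_chart_adj hX ac)/sA|exact: sH].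
Qed.

Definition affine (a b : R[i]) (l : (R[i])^o) : (R[i])^o := a + (l : R[i]) * b.

Lemma cderiv_affine (a b : R[i]) (w : (R[i])^o) :
  derivable (affine a b) w 1 /\ cderiv (affine a b) w = b.
Proof.
apply/cderivP => e e0; apply: (@nearW _ (nbhs w) _ (nbhs_filter w)) => z.
rewrite /affine opprD addrACA subrr add0r -mulrBl mulrC subrr normr0.
by apply: mulr_ge0 => //; exact: ltW.
Qed.

Lemma smooth_affine (P Q : X -> 'M[R[i]]_2) (b : R[i]) c i j : atlas c -> smooth_chart c P -> smooth_chart c Q ->
  smoothC [set u : (R * R) * (R * R) | setT (cplx u.1) /\ image2_of c u.2]
    (fun u => local_entry c (fun p => P p + (cplx u.1 * b) *: Q p) i j u.2).
Proof.
move=> ac sP sQ; have oI := open_image2 hX ac.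
rewrite (_ : [set u | _] = snd @^-1` image2_of c); last by rewrite eqEsubset; split => u //= [].
have oW : open ((@snd (R * R) (R * R)) @^-1` image2_of c).
  by apply: open_comp => // x _; exact: cvg_snd.
have lift F : smoothC (image2_of c) F -> smoothC ((@snd (R * R) (R * R)) @^-1` image2_of c) (F \o snd).
  by move=> [a d]; split=> k; [exact: (Ck_snd oI (a k))|exact: (Ck_snd oI (d k))].
apply: (eq_smoothC oW _ (smoothC_add oW (lift _ (sP i j)) (smoothC_mul oW
  (smoothC_mul oW (smoothC_cplx_fst _) (smoothC_cst _ b)) (lift _ (sQ i j))))) => u _.
by rewrite /local_entry !mxE.
Qed.

(** The canonical lift is affine in the parameter, hence defined and holomorphic on the whole plane,
    and its coefficients at 0 can be read off. *)
Lemma represents_energy (eps : R[i]) (A Phi : oneform X) s : form01 A -> form10 Phi ->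
  represents eps H A Phi s -> has_energy s (pairing Phi (fun c p => eps *: hadj H Phi c p)).
Proof.
move=> fA fP [_ hs _].
exists setT, (fun l => lin A (l * eps) (hadj H Phi)), (fun l => lin Phi l (chern H A)).
split; first split => //.
- exact: openT.
- move=> a [->|->] c i j ac; split.
  + move=> p cp l _; have := (cderiv_affine (A c p i j) (eps * hadj H Phi c p i j) l).1.
    apply: near_eq_derivable; apply: (@nearW _ (nbhs (l : (R[i])^o)) _ (nbhs_filter (l : (R[i])^o))) => z.
    by rewrite /affine /lin !mxE mulrA.
  + apply: smooth_affine => //; [by case: fA => h _; exact: h|exact: smooth_hadj].
  + move=> p cp l _; have := (cderiv_affine (Phi c p i j) (chern H A c p i j) l).1.
    apply: near_eq_derivable; apply: (@nearW _ (nbhs (l : (R[i])^o)) _ (nbhs_filter (l : (R[i])^o))) => z.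
    by rewrite /affine /lin !mxE.
  + rewrite (_ : (fun u => _) = fun u : (R * R) * (R * R) => local_entry c
        (fun p => Phi c p + (cplx u.1 * 1) *: chern H A c p) i j u.2).
      apply: smooth_affine => //; [by case: fP => h _; exact: h|exact: smooth_chern].
    by apply/funext => u; rewrite /lin mulr1.
have e1 : lin Phi 0 (chern H A) = Phi.
  by apply/funext => c; apply/funext => p; rewrite /lin scale0r addr0.
have e2 : first_order (fun l => lin A (l * eps) (hadj H Phi)) = (fun c p => eps *: hadj H Phi c p).
  apply/funext => c; apply/funext => p; apply/matrixP => i j.
  have [_ E] := cderiv_affine (A c p i j) (eps * hadj H Phi c p i j) 0.
  have EA : (fun l => lin A (l * eps) (hadj H Phi) c p i j) = affine (A c p i j) (eps * hadj H Phi c p i j).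
    by apply/funext => l; rewrite /affine /lin mxE mxE mulrA.
  by rewrite /first_order mxE EA [RHS]mxE; exact: E.
by cbv beta; rewrite e1 e2.
Qed.

End Lift.

(** * Chain rule and Wirtinger calculus *)

Section RealChain.
Context {R : realType}.
Notation R2 := (R * R)%type.
Implicit Types (h : R2 -> R) (p q : R2).

Lemma is_derive_line h p (v : R2) (s : R) : derivable h (s *: v + p) v ->
  is_derive s 1 (fun t : R => h (t *: v + p)) ('D_v h (s *: v + p)).
Proof.
have E : (fun t : R => t^-1 *: (((fun t : R => h (t *: v + p)) \o shift s) (t *: (1 : R)) - h (s *: v + p))) =
         (fun t : R => t^-1 *: ((h \o shift (s *: v + p)) (t *: v) - h (s *: v + p))).
  by apply/funext => t /=; rewrite [t *: 1]mulr1 scalerDl addrA.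
move=> dh; split; first by rewrite /derivable E.
by rewrite /derive E.
Qed.

Lemma MVT_line h p (v : R2) (t : R) :
  (forall s : R, `|s| <= `|t| -> derivable h (s *: v + p) v) ->
  exists2 s : R, `|s| <= `|t| & h (t *: v + p) - h p = t * 'D_v h (s *: v + p).
Proof.
move=> dh; pose g (s : R) := h (s *: v + p).
have dg (s : R) : `|s| <= `|t| -> is_derive s 1 g ('D_v h (s *: v + p)).
  by move=> st; apply: is_derive_line; exact: dh.
have cg (s : R) : `|s| <= `|t| -> {for s, continuous g}.
  move=> st; have [/derivable1_diffP d _] := dg s st.
  exact: differentiable_continuous.
have g0 : g 0 = h p by rewrite /g scale0r add0r.
rewrite -g0 -/(g t).
have [t0|t0] := leP 0 t.
  have [|||s + ->] := @MVT_segment _ g (fun s => 'D_v h (s *: v + p)) 0 t.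
  - exact: t0.
  - by move=> s; rewrite in_itv/= => /andP[s0 st]; apply: dg; rewrite !ger0_norm// ltW.
  - apply: continuous_in_subspaceT => s; rewrite inE /= in_itv/= => /andP[s0 st].
    by apply: cg; rewrite !ger0_norm.
  rewrite in_itv/= => /andP[s0 st]; exists s; first by rewrite !ger0_norm.
  by rewrite subr0 mulrC.
have [|||s + E] := @MVT_segment _ g (fun s => 'D_v h (s *: v + p)) t 0.
- exact: ltW.
- by move=> s; rewrite in_itv/= => /andP[s0 st]; apply: dg; rewrite (ltr0_norm st) (ltr0_norm t0) lerN2 ltW.
- apply: continuous_in_subspaceT => s; rewrite inE /= in_itv/= => /andP[s0 st].
  by apply: cg; rewrite (ler0_norm st) (ltr0_norm t0) lerN2.
rewrite in_itv/= => /andP[s0 st]; exists s; first by rewrite (ler0_norm st) (ltr0_norm t0) lerN2.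
by rewrite -opprB E sub0r mulrN opprK mulrC.
Qed.

(** Two-variable counterpart of [caratheodory]: continuity of the directional derivatives turns mean
    values into slopes with the right limits. *)
Lemma C1_slopes h (U : set R2) p : open U -> U p ->
  (forall q v, U q -> derivable h q v) ->
  (forall v, {for p, continuous ('D_v h)}) ->
  exists a b : R2 -> R, [/\
    \forall q \near p, h q - h p = (q.1 - p.1) * a q + (q.2 - p.2) * b q,
    a q @[q --> p] --> 'D_(1, 0) h p & b q @[q --> p] --> 'D_(0, 1) h p].
Proof.
move=> oU Up dh ch.
have /nbhs_ballP[r /= r0 rU] : nbhs p U by exact: open_nbhs_nbhs.
have bU q : `|q - p| < r -> U q by move=> qr; apply: rU; rewrite -ball_normE /= distrC.
have n2 (x y : R) : `|(x, y) : R2| = Num.max `|x| `|y| by rewrite prod_normE.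
have /choice[ab Hab] : forall q, exists ab : R2, `|q - p| < r ->
    h q - h p = (q.1 - p.1) * ab.1 + (q.2 - p.2) * ab.2 /\
    exists x y, [/\ `|x - p| <= `|q - p|, `|y - p| <= `|q - p|, ab.1 = 'D_(1, 0) h x & ab.2 = 'D_(0, 1) h y].
  move=> q; have [qr|qr] := boolP (`|q - p| < r); last by exists 0.
  have q1 : `|q.1 - p.1| <= `|q - p| by rewrite [leRHS]prod_normE le_max lexx.
  have q2 : `|q.2 - p.2| <= `|q - p| by rewrite [leRHS]prod_normE le_max lexx orbT.
  have b1 (s : R) : `|s| <= `|q.1 - p.1| -> `|s *: (1, 0) + (p.1, q.2) - p| <= `|q - p|.
    move=> sq; rewrite (_ : _ - p = (s, q.2 - p.2)).
      by rewrite n2 ge_max q2 (le_trans sq).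
    by case: (p) => ? ?; congr (_, _) => /=; rewrite ?[_ *: _]mulr1 ?[_ *: _]mulr0 ?add0r// addrK.
  have b2 (s : R) : `|s| <= `|q.2 - p.2| -> `|s *: (0, 1) + p - p| <= `|q - p|.
    move=> sq; rewrite addrK (_ : _ *: _ = (0, s)).
      by rewrite n2 normr0 ge_max normr_ge0 (le_trans sq).
    by congr (_, _) => /=; rewrite ?[_ *: _]mulr1 ?[_ *: _]mulr0.
  (* The path runs from p to (p.1, q.2) and on to q. In the sup norm no point on it is farther from
     p than q is. *)
  have [s sq E1] := @MVT_line h (p.1, q.2) (1, 0) (q.1 - p.1)
    (fun s hs => dh _ _ (bU _ (le_lt_trans (b1 s hs) qr))).
  have [t tq E2] := @MVT_line h p (0, 1) (q.2 - p.2)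
    (fun s hs => dh _ _ (bU _ (le_lt_trans (b2 s hs) qr))).
  exists ('D_(1, 0) h (s *: (1, 0) + (p.1, q.2)), 'D_(0, 1) h (t *: (0, 1) + p)) => _.
  split; last by exists (s *: (1, 0) + (p.1, q.2)), (t *: (0, 1) + p); split => //; [exact: b1|exact: b2].
  rewrite /= -E1 -E2.
  have -> : (q.1 - p.1) *: (1, 0) + (p.1, q.2) = q :> R2.
    by case: (q) => ? ?; congr (_, _) => /=; rewrite ?[_ *: _]mulr1 ?[_ *: _]mulr0 ?add0r// subrK.
  have -> : (q.2 - p.2) *: (0, 1) + p = (p.1, q.2) :> R2.
    by case: (p) => ? ?; congr (_, _) => /=; rewrite ?[_ *: _]mulr1 ?[_ *: _]mulr0 ?add0r// subrK.
  by rewrite addrA subrK.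
have near_r (e : R) : 0 < e -> \forall q \near p, `|q - p| < e.
  move=> e0; near=> q; rewrite distrC; near: q; exact: (@cvgr_dist_lt _ _ _ _ _ id).
have lim v (c : R2 -> R) : (forall q, `|q - p| < r -> exists2 x, `|x - p| <= `|q - p| & c q = 'D_v h x) ->
    c q @[q --> p] --> 'D_v h p.
  move=> hc; apply/(@cvgrPdist_le _ R _ (nbhs p) (nbhs_filter p)) => e e0.
  have /(@cvgrPdist_le _ R _ (nbhs p) (nbhs_filter p))/(_ e e0) := ch v.
  move=> /nbhs_ballP[d /= d0 hd].
  apply: filterS2 (near_r r r0) (near_r d d0) => q qr qd.
  have [x xq ->] := hc q qr; apply: hd.
  by rewrite -ball_normE /= distrC (le_lt_trans xq).
exists (fun q => (ab q).1), (fun q => (ab q).2); split.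
- by apply: filterS (near_r r r0) => q /Hab[].
- by apply: lim => q /Hab[_ [x [y [? _ ? _]]]]; exists x.
- by apply: lim => q /Hab[_ [x [y [_ ? _ ?]]]]; exists y.
Unshelve. all: by end_near. Qed.

(* Chain rule for [h o phi]; [phi] only has to be differentiable in the direction [e]. *)
Lemma derive_chain h (U : set R2) (phi : R2 -> R2) (v e k : R2) : open U -> U (phi v) ->
  (forall q w, U q -> derivable h q w) ->
  (forall w, {for phi v, continuous ('D_w h)}) ->
  t^-1 *: (phi (t *: e + v) - phi v) @[t --> (0:R)^'] --> k ->
  is_derive v e (h \o phi) (k.1 * 'D_(1, 0) h (phi v) + k.2 * 'D_(0, 1) h (phi v)).
Proof.
move=> oU Uv dh ch phik.
have [a [b [hab ca cb]]] := C1_slopes oU Uv dh ch.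
have cphi : phi (t *: e + v) @[t --> (0:R)^'] --> phi v.
  have -> : phi v = 0 *: k + phi v by rewrite scale0r add0r.
  have c1 : t *: (t^-1 *: (phi (t *: e + v) - phi v)) + phi v @[t --> (0:R)^'] --> 0 *: k + phi v.
    apply: cvgD; last exact: cvg_cst.
    apply: cvgZ => //; apply: (@cvg_within_filter _ _ id (nbhs (0:R))); exact: cvg_id.
  apply: cvg_trans c1; apply: near_eq_cvg; rewrite near_withinE; apply: nearW => t t0.
  by rewrite scalerA divff// scale1r subrK.
have lim : t^-1 *: (((h \o phi) \o shift v) (t *: e) - (h \o phi) v) @[t --> (0:R)^'] -->
    (k.1 * 'D_(1, 0) h (phi v) + k.2 * 'D_(0, 1) h (phi v) : R).
  have k1 : (t^-1 *: (phi (t *: e + v) - phi v)).1 @[t --> (0:R)^'] --> k.1.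
    have cf : (fst q) @[q --> k] --> k.1 by exact: cvg_fst.
    exact: (@cvg_comp _ _ _ (fun t : R => t^-1 *: (phi (t *: e + v) - phi v)) fst _ (nbhs k) (nbhs k.1) phik cf).
  have k2 : (t^-1 *: (phi (t *: e + v) - phi v)).2 @[t --> (0:R)^'] --> k.2.
    have cf : (snd q) @[q --> k] --> k.2 by exact: cvg_snd.
    exact: (@cvg_comp _ _ _ (fun t : R => t^-1 *: (phi (t *: e + v) - phi v)) snd _ (nbhs k) (nbhs k.2) phik cf).
  have ca' : a (phi (t *: e + v)) @[t --> (0:R)^'] --> 'D_(1, 0) h (phi v) .
    exact: (@cvg_comp _ _ _ (fun t : R => phi (t *: e + v)) a _ (nbhs (phi v)) _ cphi ca).
  have cb' : b (phi (t *: e + v)) @[t --> (0:R)^'] --> 'D_(0, 1) h (phi v).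
    exact: (@cvg_comp _ _ _ (fun t : R => phi (t *: e + v)) b _ (nbhs (phi v)) _ cphi cb).
  pose G (t : R) := (t^-1 *: (phi (t *: e + v) - phi v)).1 * a (phi (t *: e + v)) +
    (t^-1 *: (phi (t *: e + v) - phi v)).2 * b (phi (t *: e + v)).
  have H : G t @[t --> (0:R)^'] --> k.1 * 'D_(1, 0) h (phi v) + k.2 * 'D_(0, 1) h (phi v).
    exact: cvgD (cvgM k1 ca') (cvgM k2 cb').
  apply: cvg_trans H; apply: near_eq_cvg.
  have hn : \forall t \near (0:R)^', h (phi (t *: e + v)) - h (phi v) =
     ((phi (t *: e + v)).1 - (phi v).1) * a (phi (t *: e + v)) +
     ((phi (t *: e + v)).2 - (phi v).2) * b (phi (t *: e + v)) by exact: (cphi _ hab).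
  apply: filterS hn => t E.
  change (G t = t^-1 * (h (phi (t *: e + v)) - h (phi v))).
  by rewrite E mulrDr !mulrA.
split; first by apply/cvg_ex; eexists; exact: lim.
exact: cvg_lim lim.
Qed.

End RealChain.

Section Wirtinger.
Context {R : realType}.
Notation C := R[i].
Notation R2 := (R * R)%type.
Implicit Types (F G : R2 -> C) (e v : R2).

(** The entries of [pd] are of this form, so the matrix rules reduce to scalar ones. *)
Definition Dc e F v : C :=
  'D_e (fun w => complex.Re (F w)) v +i* 'D_e (fun w => complex.Im (F w)) v.

Definition derivC e F v : Prop :=
  derivable (fun w => complex.Re (F w)) v e /\ derivable (fun w => complex.Im (F w)) v e.

Lemma smoothC_derivC U F e v : smoothC U F -> U v -> derivC e F v.
Proof. by move=> [sr si] Uv; split; [exact: smooth_derivable sr Uv|exact: smooth_derivable si Uv]. Qed.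

Lemma DcP e F v (a b : R) : is_derive v e (fun w => complex.Re (F w)) a ->
  is_derive v e (fun w => complex.Im (F w)) b -> Dc e F v = a +i* b.
Proof. by move=> [_ A] [_ B]; rewrite /Dc A B. Qed.

Lemma Dc_add e F G v : derivC e F v -> derivC e G v ->
  derivC e (fun w => F w + G w) v /\ Dc e (fun w => F w + G w) v = Dc e F v + Dc e G v.
Proof.
move=> [/derivableP f1 /derivableP f2] [/derivableP g1 /derivableP g2].
have ER : (fun w => complex.Re (F w + G w)) = (fun w => complex.Re (F w)) + (fun w => complex.Re (G w)).
  by apply/funext => w; rewrite /= raddfD.
have EI : (fun w => complex.Im (F w + G w)) = (fun w => complex.Im (F w)) + (fun w => complex.Im (G w)).
  by apply/funext => w; rewrite /= raddfD.
have HR := is_deriveD f1 g1; have HI := is_deriveD f2 g2.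
rewrite -ER in HR; rewrite -EI in HI.
split; last by rewrite (DcP HR HI).
by split; [exact: (@ex_derive _ _ _ _ _ _ _ HR)|exact: (@ex_derive _ _ _ _ _ _ _ HI)].
Qed.

Lemma Dc_mul e F G v : derivC e F v -> derivC e G v ->
  derivC e (fun w => F w * G w) v /\ Dc e (fun w => F w * G w) v = Dc e F v * G v + F v * Dc e G v.
Proof.
move=> [/derivableP f1 /derivableP f2] [/derivableP g1 /derivableP g2].
have ER : (fun w => complex.Re (F w * G w)) = (fun w => complex.Re (F w)) * (fun w => complex.Re (G w)) -
   (fun w => complex.Im (F w)) * (fun w => complex.Im (G w)).
  by apply/funext => w; rewrite /= !fctE; case: (F w) (G w) => ? ? [].
have EI : (fun w => complex.Im (F w * G w)) = (fun w => complex.Re (F w)) * (fun w => complex.Im (G w)) +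
   (fun w => complex.Im (F w)) * (fun w => complex.Re (G w)).
  by apply/funext => w; rewrite /= !fctE; case: (F w) (G w) => ? ? [].
have HR := is_deriveB (is_deriveM f1 g1) (is_deriveM f2 g2).
have HI := is_deriveD (is_deriveM f1 g2) (is_deriveM f2 g1).
rewrite -ER in HR; rewrite -EI in HI.
split; last first.
  rewrite (DcP HR HI) /Dc; case: (F v) (G v) => a b [c d] /=.
  by rewrite /GRing.scale/=; apply/eqP; rewrite eq_complex/=; apply/andP; split; apply/eqP; ring.
by split; [exact: (@ex_derive _ _ _ _ _ _ _ HR)|exact: (@ex_derive _ _ _ _ _ _ _ HI)].
Qed.

Lemma Dc_conj e F v : derivC e F v -> Dc e (fun w => conjc (F w)) v = conjc (Dc e F v).
Proof.
move=> [/derivableP f1 /derivableP f2].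
have ER : (fun w => complex.Re (conjc (F w))) = (fun w => complex.Re (F w)) by apply/funext => w; case: (F w).
have EI : (fun w => complex.Im (conjc (F w))) = - (fun w => complex.Im (F w)).
  by apply/funext => w; rewrite fctE; case: (F w).
by have HI := is_deriveN f2; rewrite -ER in f1; rewrite -EI in HI; rewrite (DcP f1 HI) ER.
Qed.

Lemma near_Dc e F G v : (\forall w \near v, F w = G w) -> Dc e F v = Dc e G v.
Proof.
move=> FG; rewrite /Dc; congr (_ +i* _); apply: near_eq_derive; apply: filterS FG => w -> //.
Qed.

Lemma Dc_chain (U : set R2) F (phi : R2 -> R2) v e (k : R2) : open U -> U (phi v) -> smoothC U F ->
  t^-1 *: (phi (t *: e + v) - phi v) @[t --> (0:R)^'] --> k ->
  Dc e (F \o phi) v = k.1%:C * Dc (1, 0) F (phi v) + k.2%:C * Dc (0, 1) F (phi v).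
Proof.
move=> oU Uv [sr si] hk.
have ch h : smooth U h -> forall w, {for phi v, continuous ('D_w h)}.
  by move=> sh w; have /(within_continuousP _ oU) := smooth_continuous (smooth_derive w sh); exact.
have HR := derive_chain oU Uv (fun q w Uq => smooth_derivable (v := w) sr Uq) (ch _ sr) hk.
have HI := derive_chain oU Uv (fun q w Uq => smooth_derivable (v := w) si Uq) (ch _ si) hk.
rewrite (DcP HR HI) /Dc; move: ('D_(1, 0) (fun w => complex.Re (F w)) (phi v))
  ('D_(0, 1) (fun w => complex.Re (F w)) (phi v)) ('D_(1, 0) (fun w => complex.Im (F w)) (phi v))
  ('D_(0, 1) (fun w => complex.Im (F w)) (phi v)) {HR HI hk} k.1 k.2 => a b a' b' k1 k2.
by apply/eqP; rewrite eq_complex/=; apply/andP; split; apply/eqP; ring.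
Qed.

Lemma cderiv_direction (f : C^o -> C^o) v e : derivable f (cplx v) 1 ->
  t^-1 *: (plane (f (cplx (t *: e + v))) - plane (f (cplx v))) @[t --> (0:R)^'] -->
  plane (cderiv f (cplx v) * cplx e).
Proof.
move=> df; set k := cderiv f (cplx v).
have /cderivP H := conj df (erefl k).
apply/(@cvgrPdist_le _ (R2)) => r r0.
(* The added 1 keeps [M] positive when e = 0. *)
pose M := complex.Re `|cplx e| + 1.
have eM : `|cplx e| <= M%:C.
  by rewrite /M normc_def/= lecR lerDl.
have M0 : 0 < M by rewrite /M normc_def/= ltr_pwDr.
have rM : 0 < (r / M)%:C :> C by rewrite ltcR divr_gt0.
have := H _ rM => {}H.
have c0 : cplx (t *: e + v) @[t --> (0:R)] --> (cplx v : C^o).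
  have -> : cplx v = cplx (0 *: e + v) by rewrite scale0r add0r.
  apply: (@continuous_comp _ _ _ (fun t : R => t *: e + v) (@cplx R)); last exact: continuous_cplx.
  by apply: cvgD; [apply: cvgZl; exact: cvg_id|exact: cvg_cst].
have {}H : \forall t \near (0:R), `|f (cplx (t *: e + v)) - f (cplx v) - k * (cplx (t *: e + v) - cplx v)| <=
   (r / M)%:C * `|cplx (t *: e + v) - cplx v| by exact: (c0 _ H).
rewrite near_withinE; apply: filterS H => t H t0.
have E1 : cplx (t *: e + v) - cplx v = t%:C * cplx e.
  by rewrite /cplx; apply/eqP; rewrite eq_complex/=; apply/andP; split; apply/eqP; rewrite /GRing.scale/=; ring.
rewrite E1 in H.
have E2 (z1 z2 k' e' : C) : plane (k' * e') - t^-1 *: (plane z1 - plane z2) =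
   - (t^-1 *: plane (z1 - z2 - k' * (t%:C * e'))).
  case: z1 z2 k' e' => a b [a' b'] [p q] [x y].
  rewrite /plane /=; congr (_, _) => /=; rewrite /GRing.scale/=; field; exact: t0.
rewrite E2 normrN normrZ normfV ler_pdivrMl ?normr_gt0//.
apply: norm_plane_le; apply: le_trans H _; rewrite normrM.
have -> : `|t%:C| = (`|t|)%:C :> C by rewrite normc_def/= expr0n/= addr0 sqrtr_sqr.
apply: (@le_trans _ _ ((r / M)%:C * (`|t|%:C * M%:C))).
  by apply: ler_wpM2l; [exact: ltW|apply: ler_wpM2l => //; rewrite lecR].
rewrite -!rmorphM/= lecR le_eqVlt; apply/orP; left; apply/eqP; field; exact: lt0r_neq0.
Qed.

End Wirtinger.

Section Adjoint.
Context {R : realType}.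
Notation M2 := 'M[R[i]]_2.
Implicit Types M N : M2.

Lemma adjK M : adj (adj M) = M.
Proof. by apply/matrixP => i j; rewrite !mxE conjcK. Qed.

Lemma adj_mul M N : adj (M *m N) = adj N *m adj M.
Proof.
by rewrite /adj trmx_mul; apply/matrixP => i j; rewrite !mxE rmorph_sum; apply: eq_bigr => k _; rewrite !mxE rmorphM.
Qed.

Lemma adjD M N : adj (M + N) = adj M + adj N.
Proof. by apply/matrixP => i j; rewrite !mxE rmorphD. Qed.

Lemma adjN M : adj (- M) = - adj M.
Proof. by apply/matrixP => i j; rewrite !mxE rmorphN. Qed.

Lemma adjZ a M : adj (a *: M) = conjc a *: adj M.
Proof. by apply/matrixP => i j; rewrite !mxE rmorphM. Qed.

Lemma adj1 : adj (1%:M : M2) = 1%:M.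
Proof. by apply/matrixP => i j; rewrite !mxE eq_sym rmorph_nat. Qed.

End Adjoint.

Section MatrixCalculus.
Context {R : realType}.
Notation M2 := 'M[R[i]]_2.
Variables (X : @surface R) (hX : riemann_surface X).

Section InChart.
Variables (c : @chart R X) (ac : atlas c).
Implicit Types u w : X -> M2.

Lemma smooth_chart_derivC e u i j p : smooth_chart c u -> dom c p ->
  derivC e (local_entry c u i j) (plane (coord c p)).
Proof. by move=> su cp; apply: smoothC_derivC (su i j) _; exact: image2_coord. Qed.

Lemma pd_mul e u w p : smooth_chart c u -> smooth_chart c w -> dom c p ->
  pd e c (fun q => u q *m w q) p = pd e c u p *m w p + u p *m pd e c w p.
Proof.
move=> su sw cp; apply/matrixP => i j.
have U k l := @smooth_chart_derivC e u k l p su cp.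
have W k l := @smooth_chart_derivC e w k l p sw cp.
have [d0 e0] := Dc_mul (U i 0) (W 0 j).
have [d1 e1] := Dc_mul (U i 1) (W 1 j).
have [_ e2] := Dc_add d0 d1.
have pe (x : X -> M2) k l : local_entry c x k l (plane (coord c p)) = x p k l.
  by rewrite /local_entry (param_plane hX).
transitivity (Dc e (local_entry c (fun q => u q *m w q) i j) (plane (coord c p))).
  by rewrite mxE.
rewrite (_ : local_entry _ _ _ _ = fun v => local_entry c u i 0 v * local_entry c w 0 j v +
    local_entry c u i 1 v * local_entry c w 1 j v); last first.
  by apply/funext => v; rewrite /local_entry mxE big_ord2.
rewrite e2 e0 e1 !pe mxE [X in _ = X + _]mxE [X in _ = _ + X]mxE !big_ord2.
by rewrite [pd e c u p i 0]mxE [pd e c u p i 1]mxE [pd e c w p 0 j]mxE [pd e c w p 1 j]mxE addrACA.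
Qed.

Lemma pd_adj e u p : smooth_chart c u -> dom c p ->
  pd e c (fun q => adj (u q)) p = adj (pd e c u p).
Proof.
move=> su cp; apply/matrixP => i j.
have U := @smooth_chart_derivC e u j i p su cp.
transitivity (Dc e (local_entry c (fun q => adj (u q)) i j) (plane (coord c p))).
  by rewrite mxE.
rewrite (_ : local_entry _ _ _ _ = fun v => conjc (local_entry c u j i v)); last first.
  by apply/funext => v; rewrite /local_entry !mxE.
by rewrite (Dc_conj U) !mxE.
Qed.

Lemma dz_mul u w p : smooth_chart c u -> smooth_chart c w -> dom c p ->
  dz c (fun q => u q *m w q) p = dz c u p *m w p + u p *m dz c w p.
Proof.
move=> su sw cp; rewrite /dz /px /py !pd_mul// -scalemxAl -scalemxAr -scalerDr; congr (_ *: _).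
rewrite mulmxBl mulmxBr -!scalemxAl -!scalemxAr scalerDr opprD -!addrA; congr (_ + _).
by rewrite addrCA.
Qed.

Lemma dzb_mul u w p : smooth_chart c u -> smooth_chart c w -> dom c p ->
  dzb c (fun q => u q *m w q) p = dzb c u p *m w p + u p *m dzb c w p.
Proof.
move=> su sw cp; rewrite /dzb /px /py !pd_mul// -scalemxAl -scalemxAr -scalerDr; congr (_ *: _).
rewrite mulmxDl mulmxDr -!scalemxAl -!scalemxAr scalerDr -!addrA; congr (_ + _).
by rewrite addrCA.
Qed.

Lemma conjc_i : conjc (0 +i* 1 : R[i]) = - (0 +i* 1).
Proof. by apply/eqP; rewrite eq_complex/= oppr0 !eqxx. Qed.

Lemma dz_adj u p : smooth_chart c u -> dom c p ->
  dz c (fun q => adj (u q)) p = adj (dzb c u p).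
Proof.
move=> su cp; rewrite /dz /dzb /px /py !pd_adj// adjZ adjD adjZ conjc_i scaleNr.
by congr (_ *: _); rewrite fmorphV rmorph_nat.
Qed.

Lemma dzb_adj u p : smooth_chart c u -> dom c p ->
  dzb c (fun q => adj (u q)) p = adj (dz c u p).
Proof.
move=> su cp; have E : (fun q => adj (adj (u q))) = u by apply/funext => q; rewrite adjK.
by rewrite -[LHS]adjK -dz_adj ?E//; exact: (smooth_chart_adj hX ac).
Qed.

Lemma px_dz u p : px c u p = dz c u p + dzb c u p.
Proof.
rewrite /dz /dzb -scalerDr addrACA addNr addr0 -mulr2n -(scaler_nat 2 (px c u p)) scalerA mulVf ?scale1r//.
Qed.

Lemma py_dz u p : py c u p = (0 +i* 1) *: (dz c u p - dzb c u p).
Proof.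
rewrite /dz /dzb -scalerBr opprD addrACA subrr add0r -opprD -mulr2n.
have II : - ((0 +i* 1) * (0 +i* 1)) = 1 :> R[i].
  by apply/eqP; rewrite eq_complex/=; apply/andP; split; apply/eqP; ring.
move: (py c u p) II; set I := 0 +i* 1 => M II; apply/matrixP => k l.
transitivity ((- (I * I)) * M k l); first by rewrite II mul1r.
by rewrite mulr2n !mxE; field.
Qed.

End InChart.
End MatrixCalculus.

Section Pullback.
Context {R : realType}.
Notation M2 := 'M[R[i]]_2.
Variables (X Xt : @surface R) (pr : Xt -> X).
Hypotheses (hX : riemann_surface X) (hXt : universal_cover pr).
Let hXtr : riemann_surface Xt. Proof. by case: hXt. Qed.

Lemma pd_pullback (u : X -> M2) (ct : @chart R Xt) (c : @chart R X) (x : Xt) e i j :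
  atlas ct -> atlas c -> dom ct x -> dom c (pr x) -> smooth_chart c u ->
  let k := plane (dpr pr ct c x * cplx e) in
  pd e ct (u \o pr) x i j = k.1%:C * px c u (pr x) i j + k.2%:C * py c u (pr x) i j.
Proof.
move=> act ac tx cx su k.
pose v0 := plane (coord ct x).
pose phi v := plane (coord c (pr (param ct (cplx v)))).
have cv0 : cplx v0 = coord ct x by exact: planeK.
have pv0 : param ct (cplx v0) = x by rewrite cv0 (paramK hXtr).
have phi0 : phi v0 = plane (coord c (pr x)) by rewrite /phi pv0.
transitivity (Dc e (local_entry ct (u \o pr) i j) v0); first by rewrite mxE.
rewrite (@near_Dc _ _ _ (local_entry c u i j \o phi)); last first.
  have oI := open_image2 hXtr act.
  have cf : {within image2_of ct, continuous (pr \o (param ct \o cplx))}.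
    have /(within_continuousP _ oI) cp := continuous_param2 hXtr act.
    apply/(within_continuousP _ oI) => v iv; apply: continuous_comp; first exact: cp.
    exact: (covering_continuous hXt).
  have oW := open_within_preimage oI cf (open_dom hX ac).
  apply: (near_of_open oW).
    by split; [exact: image2_coord|rewrite /= pv0].
  move=> v [iv /= cv]; rewrite /local_entry /phi /=.
  by rewrite (param_plane hX).
have oI := open_image2 hX ac.
rewrite (@Dc_chain _ _ _ _ _ _ k oI _ (su i j)).
- by rewrite phi0 /px /py [pd (1, 0) c u _ i j]mxE [pd (0, 1) c u _ i j]mxE.
- by rewrite phi0; exact: image2_coord.
- have df := dpr_derivable hXt act ac tx cx; rewrite -cv0 in df.
  by rewrite /k /dpr -cv0; exact: (cderiv_direction (e := e) df).
Qed.

Lemma dzE (Y : @surface R) (u : Y -> M2) (c : @chart R Y) p i j :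
  dz c u p i j = 2^-1 * (px c u p i j - (0 +i* 1) * py c u p i j).
Proof.
rewrite /dz [LHS]mxE; congr (_ * _); rewrite [LHS]mxE; congr (_ + _).
by rewrite [LHS]mxE; congr (- _); rewrite [LHS]mxE.
Qed.

(** Cauchy-Riemann: the directions 1 and i are carried to k and i k, so the combination defining
    [dz] picks up the factor k and no \bar\partial term. *)
Lemma wirtinger_combination (k a b px py : R[i]) :
  px = (plane (k * cplx (1, 0))).1%:C * a + (plane (k * cplx (1, 0))).2%:C * b ->
  py = (plane (k * cplx (0, 1))).1%:C * a + (plane (k * cplx (0, 1))).2%:C * b ->
  2^-1 * (px - (0 +i* 1) * py) = k * (2^-1 * (a - (0 +i* 1) * b)).
Proof.
move=> -> ->; case: k => k1 k2; rewrite /cplx /plane /=.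
have -> : (k1 +i* k2) = k1%:C + (0 +i* 1) * k2%:C :> R[i].
  by apply/eqP; rewrite eq_complex/=; apply/andP; split; apply/eqP; ring.
rewrite !(mulr1, mulr0, subr0, addr0, add0r, sub0r) rmorphN/=.
have II : (0 +i* 1) * (0 +i* 1) = - 1 :> R[i].
  by apply/eqP; rewrite eq_complex/=; apply/andP; split; apply/eqP; ring.
set I := 0 +i* 1 in II *; move: (k1%:C) (k2%:C) => p q.
have -> : (p + I * q) * (2^-1 * (a - I * b)) =
   2^-1 * (p * a - p * I * b + q * I * a - (I * I) * q * b) by ring.
by rewrite II; ring.
Qed.

Lemma dz_pullback (u : X -> M2) (ct : @chart R Xt) (c : @chart R X) (x : Xt) :
  atlas ct -> atlas c -> dom ct x -> dom c (pr x) -> smooth_chart c u ->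
  dz ct (u \o pr) x = dpr pr ct c x *: dz c u (pr x).
Proof.
move=> act ac tx cx su; apply/matrixP => i j.
rewrite [RHS]mxE; apply: (etrans (dzE (u \o pr) ct x i j)).
apply: etrans (congr1 _ (esym (dzE u c (pr x) i j))).
exact: (wirtinger_combination (pd_pullback (1, 0) i j act ac tx cx su)
  (pd_pullback (0, 1) i j act ac tx cx su)).
Qed.

End Pullback.

(** * Pointwise identities *)

Section TraceAlgebra.
Context {R : realType}.
Notation M2 := 'M[R[i]]_2.
Implicit Types M N P Q : M2.

Lemma tr_mul_adj_ge0 M : 0 <= \tr (M *m adj M).
Proof.
rewrite /mxtrace; apply: sumr_ge0 => i _; rewrite mxE; apply: sumr_ge0 => j _.
by rewrite !mxE -sqr_normc exprn_ge0.
Qed.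

Lemma ge0_real (z : R[i]) : 0 <= z -> z = (complex.Re z)%:C.
Proof. by case: z => a b; rewrite lecE/= => /andP[/eqP-> _]. Qed.

(** G is upper triangular with diagonal q = sqrt (M 0 0) and t = sqrt (det M / M 0 0). *)
Lemma cholesky M : posdef M -> exists G : M2, adj G *m G = M.
Proof.
move=> [aM pM].
have Mji i j : M j i = conjc (M i j) by rewrite -{1}aM !mxE.
pose e0 : 'cV[R[i]]_2 := \col_i (i == 0)%:R.
have e00 : e0 != 0.
  by apply/eqP => /matrixP/(_ 0 0); rewrite !mxE/= => /eqP; rewrite oner_eq0.
have a0 : 0 < M 0 0.
  have := pM _ e00; rewrite !mxE big_ord2 !mxE !big_ord2 !mxE.
  rewrite eqxx (_ : (1 == 0 :> 'I_2) = false)// !(rmorph1, rmorph0).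
  by rewrite !(mul0r, mulr0, mul1r, mulr1, addr0).
(* Chosen so that M w = (0, det M); the form takes the value M 0 0 * det M at [w], which shows det M
   > 0. *)
pose w : 'cV[R[i]]_2 := \col_i (if i == 0 then - M 0 1 else M 0 0).
have w0 : w != 0.
  by apply/eqP => /matrixP/(_ 1 0); rewrite !mxE/= => /eqP; rewrite gt_eqF.
have d0 : 0 < M 0 0 * M 1 1 - M 0 1 * M 1 0.
  have := pM _ w0; rewrite !mxE big_ord2 !mxE !big_ord2 !mxE /=.
  rewrite [X in 0 < X -> _](_ : _ = M 0 0 * (M 0 0 * M 1 1 - M 0 1 * M 1 0)); first by rewrite pmulr_rgt0.
  rewrite rmorphN/= -!Mji; ring.
have [r r0 Mr] := ltc_pos a0; have [s s0 Ms] := ltc_pos d0.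
pose q := Num.sqrt r; have q0 : 0 < q by rewrite sqrtr_gt0.
have qq : (q%:C * q%:C = M 0 0 :> R[i]) by rewrite -rmorphM/= -expr2 sqr_sqrtr ?ltW// Mr.
pose t := Num.sqrt (s / r).
have tt : (t%:C * t%:C * M 0 0 = M 0 0 * M 1 1 - M 0 1 * M 1 0 :> R[i]).
  by rewrite -rmorphM/= -expr2 sqr_sqrtr ?divr_ge0 ?ltW// Mr -rmorphM/= divfK ?gt_eqF// -Mr Ms.
have q1 : q%:C != 0 :> R[i] by rewrite gt_eqF// ltcR.
have cr (a : R) : conjc a%:C = a%:C :> R[i] by rewrite /conjc /= oppr0.
exists (\matrix_(i, j) if i == 0 then (if j == 0 then q%:C else M 0 1 / q%:C)
                       else (if j == 0 then 0 else t%:C)).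
have c0 : conjc 0 = 0 :> R[i] by exact: rmorph0.
have n10 : (1 == 0 :> 'I_2) = false by [].
have cM : conjc (M 0 1 / q%:C) = M 1 0 / q%:C.
  rewrite rmorphM fmorphV; congr (_ * _^-1); [exact: esym (Mji 0 1)|exact: cr].
apply/matrixP; apply: ord2P; apply: ord2P; rewrite !mxE big_ord2 !mxE ?eqxx ?n10 ?c0 ?cr ?cM.
- by rewrite mul0r addr0.
- by rewrite mul0r addr0 mulrC divfK.
- by rewrite mulr0 addr0 divfK.
- have a1 : M 0 0 != 0 by rewrite gt_eqF.
  apply: (mulIf a1); rewrite mulrDl tt mulrACA -invfM qq divfK//.
  by rewrite mulrC addrC subrK mulrC.
Qed.

(** With M = G^* G, conjugation by G turns the M-adjoint into the ordinary one, and the trace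
    becomes that of N N^* for N = G P G^-1. *)
Lemma tr_hadj_ge0 M P : posdef M -> 0 <= \tr (P *m (invmx M *m adj P *m M)).
Proof.
move=> pM; have uM := posdef_unit pM; have [G GM] := cholesky pM.
have uG : G \in unitmx by move: uM; rewrite -GM unitmx_mul => /andP[].
have uGa : adj G \in unitmx by move: uM; rewrite -GM unitmx_mul => /andP[].
have := tr_mul_adj_ge0 (G *m P *m invmx G).
have -> : adj (G *m P *m invmx G) = invmx (adj G) *m adj P *m adj G.
  rewrite !adj_mul mulmxA; congr (_ *m _ *m _).
  by apply: (can_inj (mulKmx uGa)); rewrite mulmxV// -adj_mul mulVmx// adj1.
move=> h; rewrite -GM.
have -> : invmx (adj G *m G) = invmx G *m invmx (adj G).
  have uGG : adj G *m G \in unitmx by rewrite GM.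
  apply: (can_inj (mulKmx uGG)).
  by rewrite mulmxV// !mulmxA -[_ *m G *m _]mulmxA mulmxV// mulmx1 mulmxV.
rewrite -[G *m P *m _]mulmxA -[G *m _ *m _]mulmxA mxtrace_mulC in h.
by move: h; rewrite !mulmxA; apply.
Qed.

(** P and Q stand for [dz] f and [dzb] f, the arguments being f_x and f_y. The squares of f^-1 P and
    f^-1 Q, which carry the Hopf differential, cancel and the mixed term remains. *)
Lemma H3_normsq_sum f P Q :
  H3_normsq f (P + Q) + H3_normsq f ((0 +i* 1) *: (P - Q)) =
  complex.Re (2 * \tr (invmx f *m P *m (invmx f *m Q))).
Proof.
rewrite /H3_normsq -raddfD -mulrDr; congr complex.Re.
have II : (0 +i* 1) * (0 +i* 1) = - 1 :> R[i].
  by apply/eqP; rewrite eq_complex/=; apply/andP; split; apply/eqP; ring.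
move: (invmx f) (0 +i* 1) II => N I II.
have E (X Y : M2) : \tr (N *m X *m N *m Y) = \tr ((N *m X) *m (N *m Y)) by rewrite mulmxA.
have EI (X : M2) : \tr ((N *m (I *: X)) *m (N *m (I *: X))) = - \tr ((N *m X) *m (N *m X)).
  by rewrite -scalemxAr -scalemxAl -scalemxAr scalerA II scaleN1r raddfN.
rewrite (congr2 +%R (E (P + Q) (P + Q)) (etrans (E (I *: (P - Q)) (I *: (P - Q))) (EI (P - Q)))).
rewrite mulmxDr mulmxBr; move: (N *m P) (N *m Q) => p q.
rewrite !mulmxDl !mulmxDr !mulmxN !mulNmx opprK !mxtraceD !raddfN /= (mxtrace_mulC q p).
by field.
Qed.

(** The parallelogram law, since multiplication by i preserves the norm. *)
Lemma SU2_normsq_sum f P Q :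
  SU2_normsq f (P + Q) + SU2_normsq f ((0 +i* 1) *: (P - Q)) =
  complex.Re (\tr (P *m adj P) + \tr (Q *m adj Q)).
Proof.
rewrite /SU2_normsq -raddfD -mulrDr; congr complex.Re.
have II : (0 +i* 1) * - (0 +i* 1) = 1 :> R[i].
  by apply/eqP; rewrite eq_complex/=; apply/andP; split; apply/eqP; ring.
have EI (X : M2) : \tr (((0 +i* 1) *: X) *m adj ((0 +i* 1) *: X)) = \tr (X *m adj X).
  by rewrite adjZ conjc_i -scalemxAl -scalemxAr scalerA II scale1r.
rewrite EI !adjD adjN; move: (adj P) (adj Q) => p q.
rewrite !mulmxDl !mulmxDr !mulmxN !mulNmx opprK !mxtraceD !raddfN /=.
by field.
Qed.

End TraceAlgebra.

(** Here [a] is the part of the connection form shared by nabla^1 and nabla^-1, and [b] the part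
    that changes sign. Comparing the frames F and F f cancels [a] and doubles [b]. *)
Lemma frame_solve (R : realType) (F f a b M : 'M[R[i]]_2) (k : R[i]) : F \in unitmx ->
  F *m M = - (k *: ((a - b) *m (F *m f))) - (- (k *: ((a + b) *m F))) *m f ->
  M = (2 * k) *: (invmx F *m b *m F *m f).
Proof.
move=> uF e; apply: (can_inj (mulKmx uF)); rewrite {}e -[RHS]scalemxAr !mulmxA mulmxV// mul1mx.
rewrite mulNmx opprK -scalemxAl !mulmxDl !mulNmx.
move: (a *m F *m f) (b *m F *m f) => t1 t2.
by apply/matrixP => i j; rewrite !mxE; ring.
Qed.

Lemma adj_unit (R : realType) (M : 'M[R[i]]_2) : M \in unitmx -> adj M \in unitmx.
Proof.
move=> uM; have E : adj M *m adj (invmx M) = 1%:M by rewrite -adj_mul mulVmx// adj1.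
by case: (mulmx1_unit E).
Qed.

Lemma mulr_conjc (R : realType) (k : R[i]) : k * conjc k = `|k| ^+ 2. Proof. by rewrite sqr_normc. Qed.

(** F is an isometry onto the fibre with metric [h], so F^-1 M F has as standard norm the [h]-norm
    of M, and the unitary factor f drops out. *)
Lemma frame_norm (R : realType) (F f h M : 'M[R[i]]_2) (a : R[i]) : F \in unitmx -> h \in unitmx ->
  f *m adj f = 1%:M -> adj F *m h *m F = 1%:M ->
  \tr ((a *: (invmx F *m M *m F *m f)) *m adj (a *: (invmx F *m M *m F *m f))) =
  `|a| ^+ 2 * \tr (M *m (invmx h *m adj M *m h)).
Proof.
move=> uF uh ffa FhF.
have Fa : adj F = invmx F *m invmx h.
  apply: (can_inj (mulmxK uh)); rewrite -[RHS]mulmxA mulVmx// mulmx1.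
  by apply: (can_inj (mulmxK uF)); rewrite mulVmx.
have Fi : adj (invmx F) = h *m F.
  by apply: (can_inj (mulKmx (adj_unit uF))); rewrite -adj_mul mulVmx// adj1 mulmxA.
rewrite adjZ -scalemxAl -scalemxAr scalerA mulr_conjc mxtraceZ; congr (_ * _).
rewrite 3!adj_mul -[_ *m f *m _]mulmxA [f *m (adj f *m _)]mulmxA ffa mul1mx Fa Fi.
rewrite !mulmxA (mulmxK uF) mxtrace_mulC !mulmxA (mulmxV uF) mul1mx.
reflexivity.
Qed.

Section Pointwise.
Context {R : realType}.
Notation M2 := 'M[R[i]]_2.
Variables (X Xt : @surface R) (pr : Xt -> X) (H : X -> M2) (A Phi : @oneform R X).
Hypotheses (hX : riemann_surface X) (hXt : universal_cover pr) (hH : hermitian_metric H).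
Let hXtr : riemann_surface Xt. Proof. by case: hXt. Qed.

Lemma metric_adj q : adj (H q) = H q.
Proof. by case: hH => _ h; case: (h q). Qed.

Lemma metric_unit q : H q \in unitmx.
Proof. by case: hH => _ h; exact: posdef_unit. Qed.

Lemma metric_chern c q : H q *m chern H A c q = dz c H q - adj (A c q) *m H q.
Proof. by rewrite /chern mulmxA mulmxV ?mul1mx// metric_unit. Qed.

Lemma metric_hadj c q : H q *m hadj H Phi c q = adj (Phi c q) *m H q.
Proof. by rewrite /hadj !mulmxA mulmxV ?mul1mx// metric_unit. Qed.

Lemma adj_hadj_metric c q : adj (hadj H Phi c q) *m H q = H q *m Phi c q.
Proof.
by rewrite -[H q in LHS]metric_adj -adj_mul metric_hadj adj_mul adjK metric_adj.
Qed.

Definition Higgs_sq (c : @chart R X) (q : X) : R[i] := \tr (Phi c q *m hadj H Phi c q).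

Lemma Higgs_sq_ge0 c q : 0 <= Higgs_sq c q.
Proof. by apply: tr_hadj_ge0; case: hH. Qed.

Lemma energy_density_ge0 (k : R[i]) c q : 0 <= 8 * `|k| ^+ 2 * Higgs_sq c q.
Proof.
apply: mulr_ge0; last exact: Higgs_sq_ge0.
by apply: mulr_ge0 => //; exact: exprn_ge0.
Qed.

Section H3.
Variables (F f : Xt -> M2).
Hypotheses (hF : flat_frame 1 1 pr H A Phi F) (sf : smooth_map f)
  (fE : forall x, f x = adj (F x) *m H (pr x) *m F x).
Variables (ct : @chart R Xt) (c : @chart R X) (x : Xt).
Hypotheses (act : atlas ct) (ac : atlas c) (tx : dom ct x) (cx : dom c (pr x)).
Let k := dpr pr ct c x.
Let h := H (pr x).
Let phi := Phi c (pr x).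
Let s := hadj H Phi c (pr x).

(** Solving f = F^* H F for the metric writes it through maps smooth on [Xt], in place of a chain
    rule of every order along [pr]. *)
Lemma smooth_metric_pullback : smooth_chart ct (H \o pr).
Proof.
have [sF uF _] := hF.
have -> : H \o pr = fun x => invmx (adj (F x)) *m f x *m invmx (F x).
  apply/funext => y; rewrite fE /= !mulmxA mulVmx ?mul1mx; last exact: adj_unit.
  by rewrite -mulmxA mulmxV// mulmx1.
apply: (smooth_chart_mul hXtr act); last by apply: (smooth_chart_inv hXtr act) => //; exact: sF.
apply: (smooth_chart_mul hXtr act); last exact: sf.
apply: (smooth_chart_inv hXtr act) => [y|]; first exact: adj_unit.
by apply: (smooth_chart_adj hXtr act); exact: sF.
Qed.

Lemma dz_H3 : dz ct f x = - (2 * k) *: (adj (F x) *m h *m phi *m F x).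
Proof.
have [sF uF ff] := hF; have [E1 E2] := ff ct c x act ac tx cx.
have dF : dz ct F x = - (k *: ((chern H A c (pr x) + phi) *m F x)).
  by apply/eqP; rewrite -addr_eq0; apply/eqP; rewrite -[RHS]E1 /lin invr1 scale1r.
have dbF : dzb ct F x = - (conjc k *: ((A c (pr x) + s) *m F x)).
  by apply/eqP; rewrite -addr_eq0; apply/eqP; rewrite -[RHS]E2 /lin mulr1 scale1r.
have -> : f = fun y => (adj (F y) *m (H \o pr) y) *m F y by apply/funext => y; rewrite fE.
have sAF : smooth_chart ct (fun y => adj (F y)) by apply: (smooth_chart_adj hXtr act); exact: sF.
rewrite (dz_mul hXtr act)//; [|apply: (smooth_chart_mul hXtr act) => //; exact: smooth_metric_pullback|exact: sF].
rewrite (dz_mul hXtr act)//; last exact: smooth_metric_pullback.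
rewrite (dz_adj (sF _ act))// (dz_pullback hX hXt act ac)//; last by case: hH => sH _; exact: sH.
rewrite dF dbF -/k -/h.
have -> : dz c H (pr x) = adj (A c (pr x)) *m h + h *m chern H A c (pr x).
  by rewrite metric_chern addrC subrK.
rewrite adjN adjZ conjcK adj_mul adjD /=.
(* The derivative of F^* brings in the adjoint of [s], which crosses [h] as [phi]. It thus repeats
   the contribution of dF, whence the factor 2, while [chern] and [A] cancel against dH by metric
   compatibility. *)
have S : adj s *m h = h *m phi by exact: adj_hadj_metric.
rewrite -/h in S *; have S' : adj (F x) *m adj s *m h = adj (F x) *m h *m phi.
  by rewrite -!mulmxA S.
rewrite !(mulNmx, mulmxN) -?scalemxAl -?scalemxAr -?scalemxAl.
rewrite !(mulmxDl, mulmxDr, mulNmx) -?scalemxAl !(mulmxDl, mulmxDr) !mulmxA S'.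
move: (adj (F x) *m _ *m h *m F x) (adj (F x) *m h *m phi *m F x) (adj (F x) *m h *m _ *m F x) => t1 t2 t3.
by apply/matrixP => i j; rewrite !mxE; ring.
Qed.

Lemma energy_H3 : (H3_normsq (f x) (px ct f x) + H3_normsq (f x) (py ct f x))%:C =
  8 * `|k| ^+ 2 * Higgs_sq c (pr x).
Proof.
have [sF uF ff] := hF.
have af : (fun y => adj (f y)) = f.
  by apply/funext => y; rewrite fE !adj_mul adjK metric_adj mulmxA.
have dbf : dzb ct f x = - (2 * conjc k) *: (adj (F x) *m h *m s *m F x).
  rewrite -{1}af (dzb_adj hXtr act (sf act))// dz_H3 adjZ !adj_mul adjK metric_adj.
  rewrite rmorphN rmorphM rmorph_nat -[adj (F x) *m h *m s]mulmxA metric_hadj.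
  by congr (_ *: _); rewrite !mulmxA.
rewrite px_dz py_dz H3_normsq_sum dz_H3 dbf.
(* Presents f^-1 \partial f and f^-1 \bar\partial f as F-conjugates of multiples of [phi] and [s];
   the trace of their product forgets F. *)
have cancel M : invmx (f x) *m (adj (F x) *m h *m M *m F x) = invmx (F x) *m M *m F x.
  have uf : f x \in unitmx by rewrite fE !unitmx_mul adj_unit// metric_unit uF.
  apply: (can_inj (mulKmx uf)); rewrite mulKVmx// fE !mulmxA.
  by rewrite (mulmxK (uF x)).
rewrite -!scalemxAr -scalemxAl !cancel !mxtraceZ.
have -> : \tr (invmx (F x) *m phi *m F x *m (invmx (F x) *m s *m F x)) = Higgs_sq c (pr x).
  rewrite !mulmxA -[_ *m F x *m invmx (F x)]mulmxA mulmxV// mulmx1 mxtrace_mulC !mulmxA.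
  by rewrite mulmxV// mul1mx /Higgs_sq /hadj !mulmxA.
have E : 2 * (- (2 * conjc k) * (- (2 * k) * Higgs_sq c (pr x))) = 8 * `|k| ^+ 2 * Higgs_sq c (pr x).
  by rewrite -mulr_conjc; ring.
by rewrite E; apply/esym/ge0_real; exact: energy_density_ge0.
Qed.

End H3.

Section SU2.
Variables (F f : Xt -> M2).
Hypotheses (hF : flat_frame (- 1) 1 pr H A Phi F) (sf : smooth_map f)
  (uf : forall x, SU2 (f x)) (FH : forall x, adj (F x) *m H (pr x) *m F x = 1%:M)
  (hFf : flat_frame (- 1) (- 1) pr H A Phi (fun x => F x *m f x)).
Variables (ct : @chart R Xt) (c : @chart R X) (x : Xt).
Hypotheses (act : atlas ct) (ac : atlas c) (tx : dom ct x) (cx : dom c (pr x)).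
Let k := dpr pr ct c x.
Let h := H (pr x).
Let phi := Phi c (pr x).
Let s := hadj H Phi c (pr x).

Lemma dz_SU2 : dz ct f x = (2 * k) *: (invmx (F x) *m phi *m F x *m f x) /\
  dzb ct f x = - (2 * conjc k) *: (invmx (F x) *m s *m F x *m f x).
Proof.
have [sF uF ff] := hF; have [E1 E2] := ff ct c x act ac tx cx.
have [_ _ ff'] := hFf; have [E3 E4] := ff' ct c x act ac tx cx.
rewrite (dz_mul hXtr act (sF _ act) (sf act))// in E3.
rewrite (dzb_mul hXtr act (sF _ act) (sf act))// in E4.
have dF : dz ct F x = - (k *: ((chern H A c (pr x) + phi) *m F x)).
  by apply/eqP; rewrite -addr_eq0; apply/eqP; rewrite -[RHS]E1 /lin invr1 scale1r.
have dbF : dzb ct F x = - (conjc k *: ((A c (pr x) - s) *m F x)).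
  by apply/eqP; rewrite -addr_eq0; apply/eqP; rewrite -[RHS]E2 /lin mul1r scaleN1r.
have solve (x1 y1 z1 : M2) : x1 + y1 + z1 = 0 -> y1 = - z1 - x1.
  move=> e; transitivity ((x1 + y1 + z1) - z1 - x1); last by rewrite e sub0r.
  by rewrite addrK addrAC subrr add0r.
have e1 : F x *m dz ct f x = - (k *: ((chern H A c (pr x) - phi) *m (F x *m f x))) - dz ct F x *m f x.
  by apply: solve; rewrite -[RHS]E3 /lin invrN1 scaleN1r.
have e2 : F x *m dzb ct f x = - (conjc k *: ((A c (pr x) + s) *m (F x *m f x))) - dzb ct F x *m f x.
  by apply: solve; rewrite -[RHS]E4 /lin mulrNN mulr1 scale1r.
rewrite dF in e1; rewrite dbF in e2; clearbody s phi k.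
split; first exact: (frame_solve (uF x) e1).
(* For eps = -1 the (0,1)-parts are A - s at parameter 1 and A + s at -1, so the part changing sign
   is - s. *)
have := @frame_solve R (F x) (f x) (A c (pr x)) (- s) (dzb ct f x) (conjc k) (uF x).
rewrite opprK => /(_ e2) ->.
by rewrite mulmxN !mulNmx scalerN scaleNr.
Qed.

Lemma energy_SU2 : (SU2_normsq (f x) (px ct f x) + SU2_normsq (f x) (py ct f x))%:C =
  8 * `|k| ^+ 2 * Higgs_sq c (pr x).
Proof.
have [sF uF ff] := hF; have [dzf dbf] := dz_SU2.
have ffa : f x *m adj (f x) = 1%:M by case: (uf x).
have t1 : \tr (dz ct f x *m adj (dz ct f x)) = `|2 * k| ^+ 2 * \tr (phi *m (invmx h *m adj phi *m h)).
  by rewrite dzf; exact: (frame_norm phi (2 * k) (uF x) (metric_unit (pr x)) ffa (FH x)).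
have t2 : \tr (dzb ct f x *m adj (dzb ct f x)) =
    `|- (2 * conjc k)| ^+ 2 * \tr (s *m (invmx h *m adj s *m h)).
  by rewrite dbf; exact: (frame_norm s (- (2 * conjc k)) (uF x) (metric_unit (pr x)) ffa (FH x)).
rewrite px_dz py_dz SU2_normsq_sum.
move: (dz ct f x) (dzb ct f x) t1 t2 => ? ? -> ->.
have -> : invmx h *m adj s *m h = phi.
  by rewrite -mulmxA adj_hadj_metric mulKmx// metric_unit.
rewrite (mxtrace_mulC s phi) normrN !normrM normcJ.
have -> : `|2| = 2 :> R[i] by exact: normr_nat.
have -> : (2 * `|k|) ^+ 2 * \tr (phi *m (invmx h *m adj phi *m h)) +
  (2 * `|k|) ^+ 2 * \tr (phi *m s) = 8 * `|k| ^+ 2 * Higgs_sq c (pr x).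
  by rewrite -/(Higgs_sq c (pr x)) -/(Higgs_sq c (pr x)); ring.
by apply/esym/ge0_real; exact: energy_density_ge0.
Qed.

End SU2.
End Pointwise.

(** * Energies *)

Section ChartContinuity.
Context {R : realType} (X : @surface R) (hX : riemann_surface X).

Lemma chart_continuous (phi : X -> R) (c : @chart R X) q : atlas c ->
  {within image2_of c, continuous (phi \o param c \o cplx)} -> dom c q -> {for q, continuous phi}.
Proof.
move=> ac /(within_continuousP _ (open_image2 hX ac)) h cq.
have /(within_continuousP _ (open_dom hX ac)) hc := continuous_chart2 hX ac.
have E : forall y, dom c y -> (phi \o param c \o cplx) ((plane \o coord c) y) = phi y.
  by move=> y cy; rewrite /= (param_plane hX).
have k : ((phi \o param c \o cplx) \o (plane \o coord c)) y @[y --> q] --> phi q.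
  rewrite -[in X in _ --> X](E q cq).
  exact: (@continuous_comp _ _ _ (plane \o coord c) (phi \o param c \o cplx) q (hc q cq) (h _ (image2_coord cq))).
apply: cvg_trans k; apply: near_eq_cvg; apply: (near_of_open (open_dom hX ac) cq) => y cy.
by rewrite -(E y cy).
Qed.

Lemma metric_continuous_at (c : @chart R X) q : atlas c -> dom c q -> {for q, continuous (metric c)}.
Proof. by move=> ac; apply: chart_continuous => //; exact: metric_continuous. Qed.

Lemma trace_continuous (M : X -> 'M[R[i]]_2) (c : @chart R X) q : atlas c -> smooth_chart c M ->
  dom c q -> {for q, continuous (fun p => complex.Re (\tr (M p)))}.
Proof.
move=> ac sM; apply: chart_continuous => //.
have oI := open_image2 hX ac.
have [s0 _] := sM 0 0; have [s1 _] := sM 1 1.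
apply: (eq_within_continuous oI _ (smooth_continuous (fun k => Ck_add oI (s0 k) (s1 k)))) => v _.
by rewrite /local_entry /= /mxtrace big_ord2 raddfD.
Qed.

Lemma jac_metric (c c' : @chart R X) p : atlas c -> atlas c' -> dom c p -> dom c' p ->
  (metric c p)%:C = (metric c' p)%:C * `|jac c c' p| ^+ 2.
Proof. by move: hX => [_ [_ _ h _]]; exact: h. Qed.

End ChartContinuity.

(* No integrability is assumed: [fine] maps infinite values to [0]. *)
Lemma ge0_RintegralZl d (T : measurableType d) (R : realType) (mu : {measure set T -> \bar R})
    (D : set T) (f : T -> R) (a : R) : measurable D -> measurable_fun D f ->
  (forall x, D x -> 0 <= f x) -> Rintegral mu D (fun x => a * f x) = a * Rintegral mu D f.
Proof.
move=> mD mf f0.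
have ge0 b : 0 <= b -> Rintegral mu D (fun x => b * f x) = b * Rintegral mu D f.
  move=> b0; rewrite /Rintegral.
  have -> : (\int[mu]_(x in D) (b * f x)%:E = b%:E * \int[mu]_(x in D) (f x)%:E)%E.
    rewrite -ge0_integralZl_EFin//; exact/measurable_EFinP.
  have [->|bn0] := eqVneq b 0; first by rewrite mul0e mul0r.
  have bp : (0 < b%:E)%E by rewrite lte_fin lt_neqAle eq_sym bn0.
  case: (integral _ _ _) => [r||] //=.
    by rewrite gt0_muley//= mulr0.
  by rewrite gt0_muleNy//= mulr0.
have [a0|a0] := leP 0 a; first exact: ge0.
rewrite -[a in RHS]opprK mulNr -ge0 ?oppr_ge0 ?ltW// /Rintegral -fineN -integral_ge0N.
  by congr (fine _); apply: eq_integral => x _; rewrite mulNr EFinN oppeK.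
by move=> x Dx; rewrite lee_fin mulr_ge0 ?f0// oppr_ge0 ltW.
Qed.

Section EnergyIdentity.
Context {R : realType}.
Notation M2 := 'M[R[i]]_2.
Variables (X Xt : @surface R) (pr : Xt -> X) (H : X -> M2) (Phi : @oneform R X).
Hypotheses (hX : riemann_surface X) (hXt : universal_cover pr) (hH : hermitian_metric H).
Hypothesis fP : form10 Phi.
Let hXtr : riemann_surface Xt. Proof. by case: hXt. Qed.

Definition Higgs_density (q : X) : R :=
  complex.Re (Higgs_sq H Phi (chart_at q) q) / metric (chart_at q) q.

Lemma Higgs_sq_chart c c' q : atlas c -> atlas c' -> dom c q -> dom c' q ->
  Higgs_sq H Phi c q = `|jac c c' q| ^+ 2 * Higgs_sq H Phi c' q.
Proof.
move=> ac ac' cq c'q; have [_ h] := fP; rewrite /Higgs_sq /hadj (h _ _ _ ac ac' cq c'q).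
rewrite adjZ -scalemxAr -!scalemxAl -scalemxAr scalerA mxtraceZ.
by rewrite mulr_conjc.
Qed.

Lemma Higgs_sq_real c q : Higgs_sq H Phi c q = (complex.Re (Higgs_sq H Phi c q))%:C.
Proof. by apply: ge0_real; exact: Higgs_sq_ge0. Qed.

(** [chart_at] may jump from point to point. Numerator and metric both scale by |jac|^2, so near a
    point one fixed chart computes the density, and continuity can be checked there. *)
Lemma Higgs_densityE c q : atlas c -> dom c q ->
  Higgs_density q * metric c q = complex.Re (Higgs_sq H Phi c q).
Proof.
move=> ac cq; have [ac' cq'] := chart_atP q hX; set c' := chart_at q in ac' cq'.
apply: (@complexI R); rewrite -Higgs_sq_real (Higgs_sq_chart ac ac' cq cq') Higgs_sq_real.
rewrite /Higgs_density -/c' !rmorphM/= (jac_metric hX ac ac' cq cq') mulrA -!rmorphM/=.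
by rewrite divfK ?gt_eqF ?(metric_gt0 hX)// mulrC.
Qed.

Lemma Higgs_density_ge0 q : 0 <= Higgs_density q.
Proof.
have [ac cq] := chart_atP q hX.
rewrite divr_ge0 ?(ltW (metric_gt0 hX ac cq))// -lecR -Higgs_sq_real.
exact: Higgs_sq_ge0.
Qed.

Lemma Higgs_density_continuous : continuous Higgs_density.
Proof.
move=> q; have [ac cq] := chart_atP q hX; set c := chart_at q in ac cq.
have E p : dom c p -> complex.Re (Higgs_sq H Phi c p) / metric c p = Higgs_density p.
  by move=> cp; rewrite -(Higgs_densityE ac cp) mulfK// gt_eqF// (metric_gt0 hX).
have sM : smooth_chart c (fun p => Phi c p *m hadj H Phi c p).
  apply: (smooth_chart_mul hX ac); last exact: smooth_hadj.
  by case: fP => h _; exact: h.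
have k : complex.Re (Higgs_sq H Phi c p) / metric c p @[p --> q] --> Higgs_density q.
  rewrite -(E q cq).
  apply: cvgM; first exact: (trace_continuous hX ac sM cq).
  apply: cvgV; first by rewrite gt_eqF// (metric_gt0 hX).
  exact: metric_continuous_at.
apply: cvg_trans k; apply: near_eq_cvg; apply: (near_of_open (open_dom hX ac) cq) => p cp.
exact: E.
Qed.

Lemma measurable_Higgs_density : @measurable_fun _ _ (borel X) (measurableTypeR R) setT Higgs_density.
Proof.
apply: (@within_continuous_borelR R X setT Higgs_density openT).
apply: continuous_subspaceT; exact: Higgs_density_continuous.
Qed.

Lemma dpr_change (ct ct' : @chart R Xt) (c : @chart R X) x : atlas ct -> atlas ct' -> atlas c ->
  dom ct x -> dom ct' x -> dom c (pr x) -> dpr pr ct' c x = dpr pr ct c x * jac ct' ct x.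
Proof.
move=> act act' ac tx tx' cx.
have [_ _ _ [_ _ tr _]] := hXtr.1.
have d1 : derivable (coord ct \o param ct') (coord ct' x) 1.
  by apply: (tr _ _ act' act); exists x.
have E : (coord ct \o param ct') (coord ct' x) = coord ct x by rewrite /= (paramK hXtr).
have d2 : derivable (coord c \o pr \o param ct) ((coord ct \o param ct') (coord ct' x)) 1.
  by rewrite E; exact: (dpr_derivable hXt).
have [_] := cderiv_comp d1 d2; rewrite E => <-.
apply: near_cderiv.
have oI : open (coord ct' @` (dom ct' `&` dom ct)).
  apply: (open_chart_image hXtr act'); last exact: subIsetl.
  by apply: openI; exact: (open_dom hXtr).
apply: (near_of_open oI); first by exists x.
by move=> _ [y [y1 y2] <-]; rewrite /= (paramK hXtr act' y1) (paramK hXtr act y2).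
Qed.

(** [e] is |df|^2 in a chart, for either target; [M] exhibits it as the real part of the trace of a
    smooth matrix function, which gives continuity. *)
Variables (e : @chart R Xt -> Xt -> R) (M : @chart R Xt -> Xt -> M2).
Hypotheses (eE : forall ct c x, atlas ct -> atlas c -> dom ct x -> dom c (pr x) ->
    (e ct x)%:C = 8 * `|dpr pr ct c x| ^+ 2 * Higgs_sq H Phi c (pr x))
  (eM : forall ct x, e ct x = complex.Re (\tr (M ct x)))
  (sM : forall ct, atlas ct -> smooth_chart ct (M ct)).

Let g x := e (chart_at x) x / metric (chart_at x) x.

Lemma energy_chart ct x : atlas ct -> dom ct x -> g x * metric ct x = e ct x.
Proof.
move=> act tx; have [act' tx'] := chart_atP x hXtr; have [ac cx] := chart_atP (pr x) hX.
have m' := jac_metric hXtr act' act tx' tx.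
have e' : (e (chart_at x) x)%:C = (e ct x)%:C * `|jac (chart_at x) ct x| ^+ 2.
  rewrite (eE act ac tx cx) (eE act' ac tx' cx) (dpr_change act act' ac tx tx' cx) normrM exprMn.
  by rewrite [8 * (_ * _)]mulrA [LHS]mulrAC.
have m0 : metric ct x != 0 by rewrite gt_eqF// (metric_gt0 hXtr).
have m1 : metric (chart_at x) x != 0 by rewrite gt_eqF// (metric_gt0 hXtr).
apply: (mulIf m1); apply: (@complexI R).
rewrite /g mulrAC divfK//.
by rewrite [LHS]rmorphM [RHS]rmorphM /= e' m' [LHS]mulrAC [RHS]mulrA.
Qed.

Lemma energy_continuous : continuous g.
Proof.
move=> x; have [ac cx] := chart_atP x hXtr; set c := chart_at x in ac cx.
have E y : dom c y -> complex.Re (\tr (M c y)) / metric c y = g y.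
  by move=> cy; rewrite -eM -(energy_chart ac cy) mulfK// gt_eqF// (metric_gt0 hXtr).
have k : complex.Re (\tr (M c y)) / metric c y @[y --> x] --> g x.
  rewrite -(E x cx).
  apply: cvgM; first exact: (trace_continuous hXtr ac (sM ac) cx).
  apply: cvgV; first by rewrite gt_eqF// (metric_gt0 hXtr).
  exact: metric_continuous_at.
apply: cvg_trans k; apply: near_eq_cvg; apply: (near_of_open (open_dom hXtr ac) cx) => p cp.
exact: E.
Qed.

Lemma energy_ge0 x : 0 <= g x.
Proof.
have [act tx] := chart_atP x hXtr; have [ac cx] := chart_atP (pr x) hX.
rewrite divr_ge0 ?(ltW (metric_gt0 hXtr act tx))// -lecR (eE act ac tx cx).
exact: energy_density_ge0.
Qed.

Lemma energy_integral (D : set (borel Xt)) : fundamental_domain pr D ->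
  Rintegral (area Xt) D g = 8 * Rintegral (area X) setT Higgs_density.
Proof.
move=> hD.
have cu : continuous (fun q => 8 * Higgs_density q).
  by move=> q; apply: cvgM; [exact: cvg_cst|exact: Higgs_density_continuous].
rewrite -(@ge0_RintegralZl _ (borel X))//; last 2 first.
- exact: measurable_Higgs_density.
- by move=> q _; exact: Higgs_density_ge0.
rewrite /Rintegral (@integral_transfer R X Xt pr hX hXt (fun q => 8 * Higgs_density q) g cu energy_continuous)//.
- by move=> q; rewrite mulr_ge0// Higgs_density_ge0.
- move=> ct c x act ac tx cx; rewrite (energy_chart act tx) (eE act ac tx cx).
  have -> : 8 * Higgs_density (pr x) * metric c (pr x) = 8 * complex.Re (Higgs_sq H Phi c (pr x)).
    by rewrite -mulrA (Higgs_densityE ac cx).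
  by rewrite rmorphM rmorph_nat [X in _ = 8 * X * _]/= -Higgs_sq_real [RHS]mulrAC.
- exact: energy_ge0.
Qed.

End EnergyIdentity.

Section Pairing.
Context {R : realType}.
Notation M2 := 'M[R[i]]_2.
Variables (X : @surface R) (H : X -> M2) (Phi : @oneform R X).
Hypotheses (hX : riemann_surface X) (hH : hermitian_metric H) (fP : form10 Phi).

(** Since the trace is real, the integrand is purely imaginary; -2 i from dz /\ d\bar z over 2 pi i
    leaves -1 / pi. *)
Lemma pairing_hadj (eps : R) : pairing Phi (fun c p => eps%:C *: hadj H Phi c p) =
  (- (eps / pi) * Rintegral (area X) setT (Higgs_density H Phi))%:C.
Proof.
have E p : tr_wedge Phi (fun c p => eps%:C *: hadj H Phi c p) (chart_at p) p / (metric (chart_at p) p)%:C =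
    0 +i* ((- 2 * eps) * Higgs_density H Phi p).
  rewrite /tr_wedge -scalemxAr mxtraceZ -/(Higgs_sq H Phi (chart_at p) p) (Higgs_sq_real Phi hH).
  have [ac cp] := chart_atP p hX.
  have m0 : metric (chart_at p) p != 0 by rewrite gt_eqF// (metric_gt0 hX ac cp).
  rewrite /Higgs_density -fmorphV -!rmorphM/=.
  by apply/eqP; rewrite eq_complex/=; apply/andP; split; apply/eqP; ring.
rewrite /pairing /int2form.
have -> : Rintegral (area X) setT (fun p => complex.Re (tr_wedge Phi (fun c p => eps%:C *: hadj H Phi c p) (chart_at p) p / (metric (chart_at p) p)%:C)) = 0.
  rewrite /Rintegral (_ : (fun p => _) = fun p : borel X => 0%:E); first by rewrite integral0.
  by apply/funext => p; rewrite E.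
have -> : Rintegral (area X) setT (fun p => complex.Im (tr_wedge Phi (fun c p => eps%:C *: hadj H Phi c p) (chart_at p) p / (metric (chart_at p) p)%:C)) =
    (- 2 * eps) * Rintegral (area X) setT (Higgs_density H Phi).
  rewrite -(@ge0_RintegralZl _ (borel X))//.
  - by congr (Rintegral _ _ _); apply/funext => p; rewrite E.
  - exact: measurable_Higgs_density.
  - by move=> q _; exact: Higgs_density_ge0.
move: (Rintegral _ _ _) => I.
have p0 : pi != 0 :> R by rewrite gt_eqF// pi_gt0.
have z0 : (0 +i* (2 * pi)) != 0 :> R[i].
  by rewrite eq_complex/= negb_and mulf_neq0 ?orbT// pnatr_eq0.
apply: (mulfI z0); rewrite mulVKf//.
move: (pi : R) p0 {z0} => P P0.
by apply/eqP; rewrite eq_complex/=; apply/andP; split; apply/eqP; field.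
Qed.

End Pairing.
Arguments pairing_hadj {R X H Phi}.

Lemma map_energy_H3 (R : realType) (X Xt : @surface R) (pr : Xt -> X) (D : set (borel Xt))
    (H : X -> 'M[R[i]]_2) (A Phi : @oneform R X) (F f : Xt -> 'M[R[i]]_2) :
  riemann_surface X -> universal_cover pr -> fundamental_domain pr D -> hermitian_metric H ->
  form10 Phi -> flat_frame 1 1 pr H A Phi F -> smooth_map f ->
  (forall x, f x = adj (F x) *m H (pr x) *m F x) ->
  map_energy H3_normsq D f = 4 * Rintegral (area X) setT (Higgs_density H Phi).
Proof.
move=> hX hXt hD hH fP hF sf fE; have hXtr : riemann_surface Xt by case: hXt.
have uf x : f x \in unitmx.
  have [_ uF _] := hF; rewrite fE !unitmx_mul uF adj_unit ?uF//= andbT.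
  by case: hH => _ /(_ (pr x)); exact: posdef_unit.
pose Q (ct : @chart R Xt) x (Y : 'M[R[i]]_2) := invmx (f x) *m Y *m invmx (f x) *m Y.
rewrite /map_energy (@energy_integral R X Xt pr H Phi hX hXt hH fP
  (fun ct x => H3_normsq (f x) (px ct f x) + H3_normsq (f x) (py ct f x))
  (fun ct x => 2^-1 *: (Q ct x (px ct f x) + Q ct x (py ct f x)))) //.
- by rewrite mulrA (_ : 2^-1 * 8 = 4) //; field.
- by move=> ct c x act ac tx cx; exact: energy_H3 hF sf fE _ _ _ act ac tx cx.
- by move=> ct x; rewrite /H3_normsq -raddfD -mulrDr mxtraceZ mxtraceD.
- move=> ct act; apply: (smooth_chart_scalec hXtr act).
  have si : smooth_chart ct (fun x => invmx (f x)) by apply: (smooth_chart_inv hXtr act) => //; exact: sf.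
  have sp d : smooth_chart ct (pd d ct f) by apply: (smooth_chart_pd hXtr act); exact: sf.
  have sQ d : smooth_chart ct (fun x => Q ct x (pd d ct f x)).
    by do 3?apply: (smooth_chart_mul hXtr act) => //; exact: sp.
  by apply: (smooth_chart_add hXtr act); exact: sQ.
Qed.

Lemma map_energy_SU2 (R : realType) (X Xt : @surface R) (pr : Xt -> X) (D : set (borel Xt))
    (H : X -> 'M[R[i]]_2) (A Phi : @oneform R X) (F f : Xt -> 'M[R[i]]_2) :
  riemann_surface X -> universal_cover pr -> fundamental_domain pr D -> hermitian_metric H ->
  form10 Phi -> flat_frame (- 1) 1 pr H A Phi F -> smooth_map f -> (forall x, SU2 (f x)) ->
  (forall x, adj (F x) *m H (pr x) *m F x = 1%:M) ->
  flat_frame (- 1) (- 1) pr H A Phi (fun x => F x *m f x) ->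
  map_energy SU2_normsq D f = 4 * Rintegral (area X) setT (Higgs_density H Phi).
Proof.
move=> hX hXt hD hH fP hF sf uf FH hFf; have hXtr : riemann_surface Xt by case: hXt.
rewrite /map_energy (@energy_integral R X Xt pr H Phi hX hXt hH fP
  (fun ct x => SU2_normsq (f x) (px ct f x) + SU2_normsq (f x) (py ct f x))
  (fun ct x => 2^-1 *: (px ct f x *m adj (px ct f x) + py ct f x *m adj (py ct f x)))) //.
- by rewrite mulrA (_ : 2^-1 * 8 = 4) //; field.
- by move=> ct c x act ac tx cx; exact: energy_SU2 hF sf uf FH hFf _ _ _ act ac tx cx.
- by move=> ct x; rewrite /SU2_normsq -raddfD -mulrDr mxtraceZ mxtraceD.
- move=> ct act; apply: (smooth_chart_scalec hXtr act).
  have sp d : smooth_chart ct (pd d ct f) by apply: (smooth_chart_pd hXtr act); exact: sf.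
  have sQ d : smooth_chart ct (fun x => pd d ct f x *m adj (pd d ct f x)).
    by apply: (smooth_chart_mul hXtr act) => //; apply: (smooth_chart_adj hXtr act).
  by apply: (smooth_chart_add hXtr act); exact: sQ.
Qed.

Theorem theorem2p4 (R : realType) (X Xt : @surface R) (pr : Xt -> X)
    (D : set (borel Xt)) (H : X -> 'M[R[i]]_2)
    (hX : compact_riemann_surface X) (hXt : universal_cover pr)
    (hD : fundamental_domain pr D) (hH : hermitian_metric H) :
  ((forall (s : option R[i] -> set (dh_rep X)) (f : Xt -> 'M[R[i]]_2),
      twistor_line_of pr H s f ->
      has_energy s (- (4 * pi)^-1 * map_energy H3_normsq D f)%:C) /\
   (forall s : option R[i] -> set (dh_rep X),
      is_twistor_line H s -> exists2 e : R[i], has_energy s e & e <= 0)) /\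
  (forall (s : option R[i] -> set (dh_rep X)) (f : Xt -> 'M[R[i]]_2),
      rho_negative_of pr H s f ->
      has_energy s ((4 * pi)^-1 * map_energy SU2_normsq D f)%:C).
Proof.
have rX : riemann_surface X by case: hX.
have p0 : pi != 0 :> R by rewrite gt_eqF// pi_gt0.
split; [split|].
- move=> s f [_ [sf _] _ [A [Phi [F [[fA fP _ _ _] rep hF fE]]]]].
  have := represents_energy rX hH fA fP rep; rewrite (pairing_hadj rX hH fP 1).
  rewrite (map_energy_H3 rX hXt hD hH fP hF sf fE).
  by congr (has_energy _ _%:C); move: (pi : R) p0 => P P0; field.
(* [is_twistor_line] supplies no harmonic map, so the sign is read off the pairing directly. *)
- move=> s [A [Phi [[fA fP _ _ _] rep]]].
  eexists; first exact: (represents_energy rX hH fA fP rep).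
  rewrite (pairing_hadj rX hH fP 1) lecR mulNr oppr_le0 mulr_ge0 ?divr_ge0 ?pi_ge0//.
  rewrite fine_ge0// integral_ge0// => q _.
  by rewrite lee_fin Higgs_density_ge0.
- move=> s f [uf [sf _] _ [A [Phi [F [[fA fP _ _ _] rep hF FH hFf]]]]].
  have := represents_energy rX hH fA fP rep.
  rewrite (_ : - 1 = (- 1)%:C); last by rewrite rmorphN.
  rewrite (pairing_hadj rX hH fP (- 1)) (map_energy_SU2 rX hXt hD hH fP hF sf uf FH hFf).
  by congr (has_energy _ _%:C); move: (pi : R) p0 => P P0; field.
Qed.
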